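(* Let $S\subset[0,1]^2$ be the fractal set described in the context, and let $G:\mathbb{R}^2\to\mathbb{R}$, $G(x,\theta)=x^2-4$. There exists a locally Lipschitz function $F:\mathbb{R}^2\to\mathbb{R}$, $(x,\theta)\mapsto F(x,\theta)$, that (i) is not definable in any o-minimal structure; (ii) is differentiable and path differentiable on $\mathbb{R}^2$, and continuously differentiable on $\mathbb{R}^2\setminus S$; and (iii) is such that the set-valued map $D_f:\mathbb{R}\rightrightarrows\mathbb{R}$ given by $$D_f(\theta)=\big\{u\in\mathbb{R}:\ \exists\,(x,\lambda)\in\mathrm{Sol_{pd}}(\theta),\ (0,u)\in\partial^cF(x,\theta)+(\lambda\nabla_xG(x,\theta),0)\big\}$$ is not a conservative field for the value function $f:\mathbb{R}\to\mathbb{R}$ defined by $f(\theta)=\min_{x\in\mathbb{R}}\{F(x,\theta):G(x,\theta)\le0\}$. Moreover, $F$ and $G$ are such that: the constraint qualification [$\lambda\nabla_xG(x,\theta)=0$, $\lambda\ge0$, $\lambda G(x,\theta)=0$ imply $\lambda=0$] holds at every $(x,\theta)$ with $G(x,\theta)\le0$; and the set-valued map $\mathrm{Sol_p}:\mathbb{R}\rightrightarrows\mathbb{R}$ has nonempty values and is locally bounded.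
   Context: The set $S$. Start with the closed unit square $S_0=[0,1]^2$. Given $S_\ell$, a union of $4^\ell$ closed squares of side length $4^{-\ell}$, divide each of them into $16$ closed squares of side length $4^{-(\ell+1)}$ and keep only four, in positions fixed once and for all; the union of the kept squares is $S_{\ell+1}\subset S_\ell$. Set $S=\bigcap_{\ell}S_\ell$. The four positions are such that $S$ is nonempty, closed (hence compact), with empty interior, its projection on the first axis is $[0,1]\times\{0\}$ and on the second axis is $\{0\}\times[0,1]$, and its orthogonal projections on each axis of a suitable rotated orthonormal frame of $\mathbb{R}^2$ are Cantor sets of zero Lebesgue measure. O-minimal structures are understood on $(\mathbb{R},+,\cdot)$ and contain all real algebraic sets; a function is definable if its graph is. Conservative field. Let $\varphi:\mathbb{R}^\ell\to\mathbb{R}$ be locally Lipschitz. A set-valued map $D_\varphi:\mathbb{R}^\ell\rightrightarrows\mathbb{R}^\ell$ with nonempty values, locally bounded and with closed graph is a conservative field for $\varphi$ if for every absolutely continuous curve $u:[0,1]\to\mathbb{R}^\ell$, for almost all $t\in[0,1]$, $\frac{d}{dt}\varphi(u(t))=\langle\dot u(t),v\rangle$ for all $v\in D_\varphi(u(t))$. A locally Lipschitz function is path differentiable if it admits a conservative field. Clarke subdifferential. For $\varphi:\mathbb{R}^\ell\to\mathbb{R}$ locally Lipschitz, differentiable on the full measure set $\Omega$, $\partial^c\varphi(x)=\operatorname{conv}\{u:\exists (u_k)\subset\Omega,\ u_k\to x,\ \nabla\varphi(u_k)\to u\}$. Solutions. $\mathrm{Sol_p}(\theta)=\operatorname{argmin}\{F(x,\theta):x\in\mathbb{R},\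 G(x,\theta)\le0\}$, and $\mathrm{Sol_{pd}}(\theta)$ is the set of $(x,\lambda)\in\mathbb{R}\times\mathbb{R}$ such that $x\in\mathrm{Sol_p}(\theta)$, $\lambda\ge0$, $\lambda G(x,\theta)=0$ and $0\in\{z\in\mathbb{R}:\exists w\in\mathbb{R},\ (z,w)\in\partial^cF(x,\theta)\}+\lambda\nabla_xG(x,\theta)$. A set-valued map is locally bounded if each point has a neighborhood $\mathcal N$ such that the union of its values over $\mathcal N$ is bounded. *)

(* Defs.v *)
From HB Require Import structures.
From mathcomp Require Import all_boot all_order all_algebra.
From mathcomp Require Import all_classical all_reals all_analysis.
From mathcomp Require mpoly.
(* the notations of mpoly clash with those of MathComp-Analysis *)
Import -(notations) mpoly.

Set Implicit Arguments.
Unset Strict Implicit.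
Unset Printing Implicit Defensive.

Import Order.TTheory GRing.Theory Num.Theory.
Import numFieldNormedType.Exports.

Local Open Scope classical_set_scope.
Local Open Scope ring_scope.

(* R^n is 'rV[R]_n, with the library's (sup-norm) topology and differential;
   a point (x, t) of R^2 is [pt x t]. *)
Definition pt (R : realType) (x t : R) : 'rV[R]_2 :=
  \row_j (if j == 0 then x else t).

Definition dot (R : realType) (n : nat) (u v : 'rV[R]_n) : R :=
  \sum_(i < n) u 0 i * v 0 i.

Definition locally_lipschitz (R : realType) (V W : normedModType R)
    (f : V -> W) : Prop :=
  forall x : V, exists2 U, nbhs x U & [lipschitz f y | y in U].

Definition locally_bounded (R : realType) (V W : normedModType R)
    (D : V -> set W) : Prop :=
  forall x : V, exists2 U, nbhs x U & bounded_set (\bigcup_(y in U) D y).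

Definition gradient (R : realType) (n : nat) (phi : 'rV[R]_n -> R)
    (x : 'rV[R]_n) : 'rV[R]_n :=
  \row_i 'D_(delta_mx 0 i) phi x.

(* Meant for an open set U. *)
Definition continuously_differentiable (R : realType) (n : nat)
    (U : set 'rV[R]_n) (phi : 'rV[R]_n -> R) : Prop :=
  forall x, U x -> differentiable phi x /\ {for x, continuous (gradient phi)}.

Definition clarke (R : realType) (n : nat) (phi : 'rV[R]_n -> R)
    (x : 'rV[R]_n) : set 'rV[R]_n :=
  smallest (@convex_set R 'rV[R]_n)
    [set v | exists u : nat -> 'rV[R]_n,
      [/\ forall k, differentiable phi (u k),
          u @ \oo --> x &
          (fun k => gradient phi (u k)) @ \oo --> v]].

Definition absolutely_continuous_on (R : realType) (V : normedModType R)
    (a b : R) (u : R -> V) : Prop :=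
  forall e : R, 0 < e -> exists2 d : R, 0 < d &
    forall (m : nat) (s t : 'I_m -> R),
      (forall i, [/\ a <= s i, s i <= t i & t i <= b]) ->
      trivIset setT (fun i => [set` `]s i, t i[]) ->
      \sum_(i < m) (t i - s i) < d ->
      \sum_(i < m) `|u (t i) - u (s i)| < e.

(* The notion is only meant for a locally Lipschitz phi; this is not part of the
   predicate, so that its negation never holds merely because phi is not
   locally Lipschitz.  A curve is given by a function on R of which only the
   values on [0, 1] matter (up to the null set of endpoints). *)
Record conservative_field (R : realType) (n : nat) (phi : 'rV[R]_n -> R)
    (D : 'rV[R]_n -> set 'rV[R]_n) : Prop := ConservativeField {
  conservative_nonempty : forall x, D x !=set0 ;
  conservative_locally_bounded : locally_bounded D ;
  conservative_closed_graph :
    closed [set p : 'rV[R]_n * 'rV[R]_n | D p.1 p.2] ;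
  conservative_chain_rule : forall u : R -> 'rV[R]_n,
    absolutely_continuous_on 0 1 u ->
    {ae (@lebesgue_measure R), forall t : R, 0 <= t <= 1 ->
      [/\ derivable u t 1, derivable (phi \o u) t 1 &
          forall v, D (u t) v -> 'D_1 (phi \o u) t = dot ('D_1 u t) v]} }.

Definition path_differentiable (R : realType) (n : nat)
    (phi : 'rV[R]_n -> R) : Prop :=
  locally_lipschitz phi /\ exists D, conservative_field phi D.

(* The case of R itself, through its identification with 'rV[R]_1. *)
Definition conservative_field_line (R : realType) (f : R -> R)
    (D : R -> set R) : Prop :=
  conservative_field (fun y : 'rV[R]_1 => f (y 0 0))
    (fun y => [set v : 'rV[R]_1 | D (y 0 0) (v 0 0)]).

(* M n is the collection of the definable subsets of R^n. *)
Record o_minimal_structure (R : realType)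
    (M : forall n : nat, set (set 'rV[R]_n)) : Prop := OMinimalStructure {
  omin_algebraic : forall n (ps : seq (mpoly n R)),
    M n [set x : 'rV[R]_n | forall p : mpoly n R,
           p \in ps -> meval (fun i => x 0 i) p = 0] ;
  omin_setC : forall n A, M n A -> M n (~` A) ;
  omin_setI : forall n A B, M n A -> M n B -> M n (A `&` B) ;
  omin_setX : forall m n A B, M m A -> M n B ->
    M (m + n)%N [set z | A (lsubmx z) /\ B (rsubmx z)] ;
  omin_proj : forall n A, M (n + 1)%N A -> M n (lsubmx @` A) ;
  (* finite unions of points and open intervals are the same as finite unions of
     arbitrary intervals *)
  omin_line : forall A, M 1%N A <->
    exists s : seq (interval R), A = [set x : 'rV[R]_1 | exists2 I, I \in s & x 0 0 \in I] }.

Definition definable (R : realType) (M : forall n : nat, set (set 'rV[R]_n))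
    (n : nat) (phi : 'rV[R]_n -> R) : Prop :=
  M (n + 1)%N [set z : 'rV[R]_(n + 1) | rsubmx z 0 0 = phi (lsubmx z)].

Section Fractal.
Variable R : realType.
(* (i, j) \in P when the subsquare in column i and row j of the 4 x 4 subdivision
   is kept. *)
Variable P : {set 'I_4 * 'I_4}.

(* lower left corners of the squares of S_l, whose side is 4^-l *)
Fixpoint corners (l : nat) : set 'rV[R]_2 :=
  if l is k.+1 then
    [set c + 4 ^- k.+1 *: pt (p.1 : nat)%:R (p.2 : nat)%:R
      | c in corners k & p in [set` P]]
  else [set 0].

Definition square (c : 'rV[R]_2) (s : R) : set 'rV[R]_2 :=
  [set z | forall i, c 0 i <= z 0 i <= c 0 i + s].

Definition fractal : set 'rV[R]_2 :=
  \bigcap_l \bigcup_(c in corners l) square c (4 ^- l).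

End Fractal.
Arguments fractal : clear implicits.

Definition cantor_set (R : realType) (A : set R) : Prop :=
  [/\ A !=set0, compact A, perfect_set A & totally_disconnected A].

(* For instance P = {(0,1), (1,3), (2,0), (3,2)}, with the frame
   (1,2)/sqrt 5, (2,-1)/sqrt 5. *)
Record admissible_positions (R : realType) (P : {set 'I_4 * 'I_4}) : Prop :=
    AdmissiblePositions {
  positions_card : #|P| = 4%N ;
  fractal_nonempty : fractal R P !=set0 ;
  fractal_closed : closed (fractal R P) ;
  fractal_interior : interior (fractal R P) = set0 ;
  fractal_proj_fst : [set z 0 0 | z in fractal R P] = [set` `[0, 1]] ;
  fractal_proj_snd : [set z 0 1 | z in fractal R P] = [set` `[0, 1]] ;
  fractal_proj_frame : exists e1 e2 : 'rV[R]_2,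
    [/\ dot e1 e1 = 1, dot e2 e2 = 1, dot e1 e2 = 0 &
      forall e, e = e1 \/ e = e2 ->
        cantor_set [set dot z e | z in fractal R P] /\
        lebesgue_measure [set dot z e | z in fractal R P] = 0%E] }.

Section Parametric.
Variables (R : realType) (F G : 'rV[R]_2 -> R).

Definition dx (x t : R) : R := 'D_1 (fun y => G (pt y t)) x.

Definition feasible (t : R) : set R := [set x | G (pt x t) <= 0].

Definition Sol_p (t : R) : set R :=
  [set x | feasible t x /\ forall y, feasible t y -> F (pt x t) <= F (pt y t)].

Definition Sol_pd (t : R) : set (R * R) :=
  [set xl | [/\ Sol_p t xl.1, 0 <= xl.2, xl.2 * G (pt xl.1 t) = 0 &
    exists2 z, (exists w, clarke F (pt xl.1 t) (pt z w)) &
      0 = z + xl.2 * dx xl.1 t]].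

Definition D_value (t : R) : set R :=
  [set u | exists2 xl, Sol_pd t xl &
    exists2 v, clarke F (pt xl.1 t) v & pt 0 u = v + pt (xl.2 * dx xl.1 t) 0].

(* a minimum as soon as Sol_p t is nonempty, see value_functionE *)
Definition value_function (t : R) : R :=
  inf [set F (pt x t) | x in feasible t].

Lemma value_functionE (t x : R) : Sol_p t x -> value_function t = F (pt x t).
Proof.
move=> [fx xmin]; apply/eqP; rewrite eq_le; apply/andP; split.
  by apply: ge_inf; [exists (F (pt x t)) => _ [y /xmin + <-] | exists x].
by apply: lb_le_inf; [exists (F (pt x t)), x | move=> _ [y /xmin + <-]].
Qed.

Definition constraint_qualification (x t : R) : Prop :=
  forall l : R, l * dx x t = 0 -> 0 <= l -> l * G (pt x t) = 0 -> l = 0.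

End Parametric.

(* Main.v *)
Require Import Defs.
From HB Require Import structures.
From mathcomp Require Import all_boot all_order all_algebra.
From mathcomp Require Import all_classical all_reals all_analysis.
From mathcomp Require Import measurable_realfun.
From mathcomp Require Import ring lra.
From mathcomp Require mpoly.
Import -(notations) mpoly.
Set Implicit Arguments.
Unset Strict Implicit.
Unset Printing Implicit Defensive.
Import Order.TTheory GRing.Theory Num.Theory.
Import numFieldNormedType.Exports.
Local Open Scope classical_set_scope.
Local Open Scope ring_scope.

(** The function is F(x, t) = sin t + f(x, t), where f >= 0 is a sum of bumps with
pairwise disjoint supports, whose centers tend to S.

A bump centered at a point p outside S has a radius of the order of the square
of the distance from p to S.  Hence f is bounded by the square of the distance
to S, so it vanishes on S and is differentiable there with zero gradient.  On the
other hand the height of a bump is its radius, so that its gradient takes the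
value (0, - 3/2) whatever the radius ([bump_slope]).  As the projection of S on
the second axis is [0, 1] and S is compact with empty interior, the bumps can be
placed so that above every t in [0, 1[ some point (x, t) of S is a limit of
points where the gradient of f has that value ([oscillating_field]).

Such a point minimizes F(., t), because f is zero on S, and the constraint is
inactive there.  The Clarke subdifferential of F at (x, t) contains both the
gradient (0, cos t) and the limit (0, cos t - 3/2).  Thus D_f(t) has two distinct
elements for all t in ]0, 1[, and the chain rule of a conservative field fails
along the curve t |-> t ([not_conservative_field_line]).

Yet F is path differentiable, because a curve u meets S with zero velocity at
almost every time ([null_frame_velocity]): each of two orthogonal coordinates of
u takes its values in a null set at the times when u is in S, and the derivative
of a real function vanishes almost everywhere on the preimage of a null set
([derive_null_preimage]).  So the gradient of F, completed by a ball at the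
points of S, is a conservative field ([path_differentiable_off_null]).  This
needs that absolutely continuous curves are differentiable almost everywhere
([absolutely_continuous_derivable]): an absolutely continuous function is a
difference of two nondecreasing ones, whose Stieltjes measures have densities
with respect to the Lebesgue measure; the Lebesgue differentiation theorem
applies to the integrals of these densities.

Finally F(3, t) = sin t, since f is zero far from S.  The zero set of the sine
function is not a finite union of intervals, so F is not definable. *)

(** * Row vectors *)

Section row_vectors.
Context {R : realType} {n : nat}.
Implicit Types (x : 'rV[R]_n.+1).

Lemma row_norm_ge x i : `|x 0 i| <= `|x|.
Proof.
by rewrite [leRHS]/Num.Def.normr/= mx_normrE; exact: (le_bigmax _ _ (0, i)).
Qed.

Lemma row_norm_le x (c : R) : 0 <= c -> (forall i, `|x 0 i| <= c) -> `|x| <= c.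
Proof.
move=> c0 xc; rewrite [leLHS]/Num.Def.normr/= mx_normrE bigmax_le// => -[i j] _.
by rewrite /= (ord1 i).
Qed.

End row_vectors.

Lemma near_dist (R : realType) (V : normedModType R) (x : V) (e : R) :
  0 < e -> \forall y \near x, `|x - y| < e.
Proof. by apply: (@cvgr_dist_lt _ _ _ (nbhs x) _ id x); exact: cvg_id. Qed.

Section plane.
Context {R : realType}.

Lemma rV2P (P : 'I_2 -> Prop) : P 0 -> P 1 -> forall i, P i.
Proof.
move=> P0 P1 [[|[|//]] i2]; [move: P0|move: P1].
  by rewrite (_ : Ordinal _ = 0)//; exact/val_inj.
by rewrite (_ : Ordinal _ = 1)//; exact/val_inj.
Qed.

Lemma pt0 (x t : R) : pt x t 0 0 = x. Proof. by rewrite mxE. Qed.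
Lemma pt1 (x t : R) : pt x t 0 1 = t. Proof. by rewrite mxE. Qed.

Lemma pt_eta (z : 'rV[R]_2) : pt (z 0 0) (z 0 1) = z.
Proof. by apply/rowP; apply: rV2P; rewrite mxE. Qed.

Lemma cvg_pt (T : Type) (F : set_system T) {FF : Filter F} (f g : T -> R)
    (a b : R) :
  f @ F --> a -> g @ F --> b -> (fun t => pt (f t) (g t)) @ F --> pt a b.
Proof.
have ptE (x t : R) : pt x t = x *: pt 1 0 + t *: pt 0 1.
  by apply/rowP; apply: rV2P; rewrite !mxE/= ?mulr1 ?mulr0 ?addr0 ?add0r.
move=> fa gb; rewrite ptE; under eq_fun do rewrite ptE.
by apply: cvgD; apply: cvgZr_tmp.
Qed.

End plane.

(** * Absolutely continuous functions are differentiable almost everywhere *)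

Section ac_families.
Context {R : realType}.
Implicit Types (a b : R) (p q : R * R) (l : seq (R * R)) (s : seq R).

Definition apart p q := (p.2 <= q.1) || (q.2 <= p.1).

(** Finite families of disjoint open intervals are lists of pairs here, so that one
interval can be replaced by the intervals of a partition. *)
Definition itv_family a b l :=
  all (fun p => [&& a <= p.1, p.1 < p.2 & p.2 <= b]) l && pairwise apart l.

Fixpoint pieces a s :=
  if s is x :: s' then (a, x) :: pieces x s' else [::].

Lemma variation_pieces a b (f : R -> R) s : itv_partition a b s ->
  variation a b f s = \sum_(p <- pieces a s) `|f p.2 - f p.1|.
Proof.
move=> abs; rewrite variation_zip// => {abs}.
elim: s a => [|x s ih] a /=; first by rewrite !big_nil.
by rewrite !big_cons ih.
Qed.

Lemma sum_pieces a b s : itv_partition a b s ->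
  \sum_(p <- pieces a s) (p.2 - p.1) = b - a.
Proof.
elim: s a => [|x s ih] a abs /=.
  by rewrite big_nil (itv_partition_nil abs) subrr.
by rewrite big_cons (ih x (itv_partition_cons abs))/= addrC subrKA.
Qed.

Lemma pieces_family a b s : itv_partition a b s -> itv_family a b (pieces a s).
Proof.
elim: s a => [|x s ih] a abs //=.
have xbs := itv_partition_cons abs.
have ax : a < x by case: abs => /= /andP[].
have xb := itv_partition_le xbs.
have /andP[inx px] := ih x xbs.
rewrite /itv_family /= lexx ax xb px /= andbT; apply/andP; split.
  apply: sub_all inx => p /and3P[xp -> ->].
  by rewrite (le_trans (ltW ax)).
by apply: sub_all inx => p /and3P[xp _ _]; rewrite /apart /= xp.
Qed.

(** Refining one interval keeps the family disjoint and does not change its total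
length, which is what an induction over the intervals needs. *)
Lemma refine_family a b l1 l2 p s : itv_partition p.1 p.2 s ->
  itv_family a b (l1 ++ p :: l2) ->
  itv_family a b ((l1 ++ pieces p.1 s) ++ l2).
Proof.
move=> /pieces_family/andP[/allP ps pp].
rewrite /itv_family -catA !all_cat /= !pairwise_cat /= allrel_consr allrel_catr.
move=> /and3P[/and3P[-> /and3P[ap pq pb] -> /=] /andP[/allP l1p ->]].
move=> /and3P[-> /allP pl2 ->]; rewrite pp/= !andbT; apply/and3P; split.
- by apply/allP => q /ps/and3P[? -> ?]; rewrite (le_trans ap)// (le_trans _ pb).
- apply/allrelP => x y /l1p + /ps/and3P[? _ ?]; rewrite /apart.
  by case/orP => h; apply/orP; [left|right]; lra.
- apply/allrelP => x y /ps/and3P[? _ ?] /pl2; rewrite /apart.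
  by case/orP => h; apply/orP; [left|right]; lra.
Qed.

Definition ac_family a b (f : R -> R) := forall e : R, 0 < e ->
  exists2 d : R, 0 < d & forall l, itv_family a b l ->
    \sum_(p <- l) (p.2 - p.1) < d -> \sum_(p <- l) `|f p.2 - f p.1| < e.

Lemma absolutely_continuous_on_family a b (f : R -> R) :
  absolutely_continuous_on a b f -> ac_family a b f.
Proof.
move=> fac e /fac[d d0 fd]; exists d => // l /andP[/allP lab lp].
rewrite big_tnth => ld; rewrite big_tnth.
apply: (fd _ (fun i => (tnth (in_tuple l) i).1)
             (fun i => (tnth (in_tuple l) i).2)) => // [i|].
  have /lab/and3P[? ? ?] := mem_tnth i (in_tuple l).
  by split=> //; exact: ltW.
have sub (i j : 'I_(size l)) (x : R) : (i < j)%N ->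
    x \in `](tnth (in_tuple l) i).1, (tnth (in_tuple l) i).2[ ->
    x \in `](tnth (in_tuple l) j).1, (tnth (in_tuple l) j).2[ -> False.
  move=> ij; rewrite !(tnth_nth (0, 0))/= !in_itv/=.
  have /(pairwiseP (0, 0))/(_ i j) := lp.
  rewrite !inE !ltn_ord => /(_ isT isT ij); rewrite /apart.
  by case/orP => h /andP[? ?] /andP[? ?]; lra.
apply/trivIsetP => i j _ _ ij; rewrite -subset0 => x [/= xi xj].
have [ij'|ij'] := ltnP i j; first exact: (sub i j x).
by apply: (sub j i x) => //; rewrite ltn_neqAle ij' eq_sym andbT.
Qed.

Local Notation TV := total_variation.

(** The total variation inherits absolute continuity.  The suprema defining the
variations are handled one interval at a time: an interval is replaced by the
pieces of an arbitrary partition, and the sum over the intervals treated so far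
is one of the sums controlled by absolute continuity. *)
Lemma ac_family_total_variation a b f : ac_family a b f ->
  forall e, 0 < e -> exists2 d : R, 0 < d &
    forall l, itv_family a b l -> \sum_(p <- l) (p.2 - p.1) < d ->
    (\sum_(p <- l) TV p.1 p.2 f <= e%:E)%E.
Proof.
move=> fac e /fac[d d0 fd]; exists d => // l lab ld.
(* l1 holds the pieces already chosen, l2 the intervals still to be refined *)
suff H l1 l2 : itv_family a b (l1 ++ l2) ->
    \sum_(p <- l1 ++ l2) (p.2 - p.1) < d ->
    ((\sum_(p <- l1) `|f p.2 - f p.1|)%:E +
     \sum_(p <- l2) TV p.1 p.2 f <= e%:E)%E.
  by have := H [::] l lab ld; rewrite big_nil add0e.
elim: l2 l1 => [|p l2 ih] l1.
  by rewrite cats0 big_nil adde0 lee_fin => ? ?; apply/ltW/fd.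
move=> fam lend; rewrite big_cons addeCA.
have p12 : p.1 < p.2.
  by case/andP: fam; rewrite all_cat /= => /and3P[_ /and3P[]].
have step s : itv_partition p.1 p.2 s ->
    ((variation p.1 p.2 f s)%:E + ((\sum_(p <- l1) `|f p.2 - f p.1|)%:E +
     \sum_(p <- l2) TV p.1 p.2 f) <= e%:E)%E.
  move=> ps; have := ih (l1 ++ pieces p.1 s) (refine_family ps fam).
  rewrite !big_cat/= (sum_pieces ps) -(variation_pieces _ ps).
  rewrite EFinD -addeA addeCA; apply.
  by rewrite -addrA; move: lend; rewrite big_cat big_cons.
set Y := (_%:E + _)%E in step *.
have Y0 : (0 <= Y)%E.
  rewrite adde_ge0 ?lee_fin ?sumr_ge0// big_seq sume_ge0// => q ql2.
  apply: total_variation_ge0; case/andP: fam => /allP/(_ q).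
  by rewrite mem_cat inE ql2 !orbT => /(_ isT)/and3P[_ /ltW].
have Yfin : Y \is a fin_num.
  rewrite ge0_fin_numE//; apply: le_lt_trans (ltry e).
  apply: le_trans (step _ (itv_partition1 p12)).
  by rewrite leeDr// lee_fin variation_ge0.
rewrite -leeBrDr//; apply: ge_ereal_sup => _ [_ [s ps <-] <-].
by rewrite leeBrDr// step.
Qed.

(** The variation is at most 1 on intervals shorter than the d given by absolute
continuity for e = 1, and finitely many of these cover [a, b]. *)
Lemma ac_family_bounded_variation a b f : a <= b -> ac_family a b f ->
  bounded_variation a b f.
Proof.
move=> ab /ac_family_total_variation/(_ 1 ltr01)[d d0 fd].
have d2 : 0 < d / 2 by rewrite divr_gt0.
have short (s t : R) : a <= s -> s <= t -> t <= b -> t - s < d ->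
    TV s t f \is a fin_num.
  move=> as_ + tb std; rewrite le_eqVlt => /predU1P[<-|st].
    by rewrite total_variationxx.
  rewrite ge0_fin_numE ?total_variation_ge0 ?ltW//.
  have := fd [:: (s, t)]; rewrite !big_seq1/= => /(_ _ std)/le_lt_trans; apply.
    by rewrite /itv_family/= as_ st tb.
  exact: ltry.
(* induction along steps of length d / 2 *)
have fin (n : nat) t : a <= t -> t <= b -> t <= a + n%:R * (d / 2) ->
    TV a t f \is a fin_num.
  elim: n t => [|n ih] t at_ tb tn.
    by apply: short => //; lra.
  have [ta|ta] := leP t (a + n%:R * (d / 2)); first exact: ih.
  have an : a <= a + n%:R * (d / 2) by rewrite lerDl mulr_ge0// ltW.
  rewrite (@total_variationD _ _ _ (a + n%:R * (d / 2)))// ?ltW//.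
  rewrite fin_numD ih//; last by rewrite (le_trans (ltW ta)).
  apply: short => //; first exact: ltW.
  by move: tn; rewrite -natr1 mulrDl mul1r; lra.
apply/bounded_variationP => //.
apply: (fin (Num.bound ((b - a) / (d / 2)))) => //.
rewrite -lerBlDl -ler_pdivrMr// ltW// archi_boundP//.
by rewrite divr_ge0 ?subr_ge0// ltW.
Qed.

Lemma ac_family_right_continuous a b f x : a <= x -> x < b ->
  ac_family a b f -> f @ x^'+ --> f x.
Proof.
move=> ax xb fac; apply/cvgrPdist_lt => e /fac[d d0 fd].
near=> t; have xt : x < t by near: t; exact: nbhs_right_gt.
have := fd [:: (x, t)]; rewrite !big_seq1/= distrC; apply.
  rewrite /itv_family/= ax xt !andbT/=; near: t; exact: nbhs_right_le.
rewrite ltrBlDl; near: t; apply: nbhs_right_lt; rewrite ltrDl//.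
Unshelve. all: by end_near. Qed.

End ac_families.

Section stieltjes.
Context {R : realType}.
Implicit Types (a b : R) (v : cumulative R R).
Local Notation mu := (@lebesgue_measure R).

Lemma stieltjes_itv v (s t : R) : s <= t ->
  lebesgue_stieltjes_measure v `]s, t] = (v t - v s)%:E.
Proof.
move=> st; rewrite /lebesgue_stieltjes_measure/= /measure_extension.
by rewrite measurable_mu_extE/= ?wlength_itv_bnd//; exact: is_ocitv.
Qed.

Lemma open_interval_itv (I : set R) a b : open I -> is_interval I ->
  I `<=` `]a, b[ -> I !=set0 ->
  [/\ I = `]inf I, sup I[%classic, a <= inf I, inf I < sup I & sup I <= b].
Proof.
move=> oI iI Iab I0.
have lI : has_lbound I by exists a => x /Iab/=; rewrite in_itv/= => /andP[/ltW].
have uI : has_ubound I.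
  by exists b => x /Iab/=; rewrite in_itv/= => /andP[_ /ltW].
have IE : I = `]inf I, sup I[%classic.
  rewrite -[LHS](interior_id I).1// (interval_bounded_interior iI lI uI).
  by apply/seteqP; split => x /=; rewrite in_itv.
split=> //.
- by apply: lb_le_inf => // x /Iab/=; rewrite in_itv/= => /andP[/ltW].
- case: I0 => x Ix; have : `]inf I, sup I[%classic x by rewrite -IE.
  by rewrite /= in_itv/= => /andP[]; exact: lt_trans.
- by apply: ge_sup => // x /Iab/=; rewrite in_itv/= => /andP[_ /ltW].
Qed.

Lemma itv_apart (p q : R * R) : p.1 < p.2 -> q.1 < q.2 ->
  `]p.1, p.2[%classic `&` `]q.1, q.2[%classic = set0 -> apart p q.
Proof.
move=> pp qq; apply: contraPT; rewrite /apart negb_or -!ltNge => /andP[qp pq].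
apply/eqP/set0P; exists ((Num.max p.1 q.1 + Num.min p.2 q.2) / 2) => /=.
(* this witness is the midpoint of the intersection *)
rewrite !in_itv/=.
by case: (leP p.1 q.1) => ?; case: (leP p.2 q.2) => ?;
  split; apply/andP; split; lra.
Qed.

(** An open set is a countable disjoint union of open intervals, and absolute
continuity controls each of its finite subfamilies, hence the limit. *)
Lemma stieltjes_open_small v a b : ac_family a b v ->
  forall e, 0 < e -> exists2 d, 0 < d & forall U : set R, open U ->
    U `<=` `]a, b[ -> (mu U < d%:E)%E ->
    (lebesgue_stieltjes_measure v U <= e%:E)%E.
Proof.
move=> vac e /vac[d d0 vd]; exists d => // U oU Uab.
pose I := open_disjoint_itv oU.
have oI i : open (I i) by exact: open_disjoint_itv_open.
have mI (i : nat) : measurable (I i) by exact: open_measurable.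
have tI : trivIset setT I by exact: open_disjoint_itv_trivIset.
have UE : U = \bigcup_i I i by exact: open_disjoint_itv_bigcup.
have IP i : I i != set0 -> [/\ I i = `]inf (I i), sup (I i)[%classic,
    a <= inf (I i), inf (I i) < sup (I i) & sup (I i) <= b].
  move=> /set0P; apply: open_interval_itv => //.
    exact: open_disjoint_itv_is_interval.
  by apply: subset_trans Uab; rewrite UE; exact: bigcup_sup.
have lenI i : (mu (I i) = (if I i != set0 then sup (I i) - inf (I i) else 0)%:E)%E.
  case: ifPn => [/IP[IE _ lt _]|/negPn/eqP ->]; last by rewrite measure0.
  by rewrite IE lebesgue_measure_itv/= lte_fin -IE lt -EFinB.
have varI i : (lebesgue_stieltjes_measure v (I i) <=
    (if I i != set0 then `|v (sup (I i)) - v (inf (I i))| else 0)%:E)%E.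
  case: ifPn => [/IP[IE _ lt _]|/negPn/eqP ->]; last by rewrite measure0.
  rewrite (@le_trans _ _ (lebesgue_stieltjes_measure v `]inf (I i), sup (I i)]))//.
    rewrite {1}IE; apply: le_measure; rewrite ?inE; try exact: measurable_itv.
    exact: subset_itv_oo_oc.
  by rewrite stieltjes_itv ?lee_fin ?ler_norm// ltW.
have mU : measurable (\bigcup_i I i) by exact: bigcupT_measurable.
rewrite UE !measure_semi_bigcup// => Ud.
apply: lime_le; first by apply: is_cvg_nneseries.
apply: nearW => n.
rewrite (le_trans (lee_sum _ (fun i _ => varI i)))// sumEFin lee_fin.
pose l := [seq (inf (I i), sup (I i)) | i <- iota 0 n & I i != set0].
suff : \sum_(p <- l) `|v p.2 - v p.1| < e.
  by rewrite big_map big_filter/= big_mkcond/= /index_iota subn0 => /ltW.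
apply: vd.
  apply/andP; split.
    by apply/allP => _ /mapP[i] + ->; rewrite mem_filter => /andP[/IP[_ -> -> ->]].
  rewrite pairwise_map.
  apply: (@sub_in_pairwise _ (fun i => I i != set0) (fun i j => i != j)).
  - move=> i j; rewrite -!topredE/= => I0 J0 ij.
    have [IE _ iI _] := IP _ I0; have [JE _ jI _] := IP _ J0.
    apply: itv_apart => //=; rewrite -IE -JE.
    by move/trivIsetP : tI; exact.
  - exact: filter_all.
  - by rewrite -uniq_pairwise filter_uniq// iota_uniq.
rewrite big_map big_filter/= big_mkcond/= -lte_fin -sumEFin.
apply: le_lt_trans Ud; under eq_bigr do rewrite -lenI.
have -> : iota 0 n = index_iota 0 n by rewrite /index_iota subn0.
exact: (@nneseries_lim_ge _ (fun i => mu (I i)) xpredT).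
Qed.

End stieltjes.

Section ac_cumulative.
Context {R : realType}.
Implicit Types (a b : R) (v : cumulative R R).
Local Notation mu := (@lebesgue_measure R).

(** By outer regularity a null set is contained in open sets of arbitrarily small
Lebesgue measure, whose Stieltjes measure is then small too. *)
Lemma stieltjes_itv_dominated v a b
    (moo : (lebesgue_stieltjes_measure v `]a, b[ < +oo)%E) :
  ac_family a b v -> mfrestr (measurable_itv `]a, b[) moo `<< mu.
Proof.
move=> vac; apply/null_content_dominatesP => A mA A0.
apply/eqP; rewrite eq_le measure_ge0 andbT; apply/lee_addgt0Pr => e e0.
rewrite add0e /mfrestr/= /mrestr.
have [d d0 vd] := stieltjes_open_small vac e0.
have mD : measurable `]a, b[ by exact: measurable_itv.
have mB : measurable (A `&` `]a, b[) by exact: measurableI.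
have B0 : mu (A `&` `]a, b[) = 0%E.
  by apply/eqP; rewrite eq_le measure_ge0 andbT -A0 le_measure ?inE.
have Boo : (mu (A `&` `]a, b[) < +oo)%E by rewrite B0 ltry.
have [U [oU BU Ud]] := lebesgue_regularity_outer mB Boo d0.
have mU : measurable U by exact: open_measurable.
have oUD : open (U `&` `]a, b[) by apply: openI => //; exact: interval_open.
apply: (@le_trans _ _ (lebesgue_stieltjes_measure v (U `&` `]a, b[))).
  apply: le_measure; rewrite ?inE//; first exact: measurableI.
  by move=> x [Ax Dx]; split => //; exact: BU.
apply: vd => //; apply: le_lt_trans Ud.
apply: (@le_trans _ _ (mu ((A `&` `]a, b[) `|` (U `\` (A `&` `]a, b[))))).
  apply: le_measure; rewrite ?inE//; first exact: measurableI.
    by apply: measurableU => //; exact: measurableD.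
  move=> x [Ux _]; have [Bx|Bx] := pselect ((A `&` `]a, b[) x); [left|right] => //.
apply: le_trans (measureU2 _ _ _) _ => //; first exact: measurableD.
by rewrite -[leRHS]add0e; apply: leeD => //; rewrite -B0.
Qed.

(** The measure of ]a, x] is v x - v a, and it is the integral over ]a, x] of the
Radon-Nikodym density of the Stieltjes measure; the Lebesgue differentiation
theorem concludes. *)
Lemma ac_cumulative_derivable v a b : ac_family a b v ->
  {ae mu, forall x, a < x < b -> derivable v x 1}.
Proof.
move=> vac; have [ab|ba] := ltP a b; last first.
  by apply: aeW => x /andP[ax xb]; move: (lt_trans ax xb); rewrite ltNge ba.
have mD : measurable `]a, b[ by exact: measurable_itv.
have moo : (lebesgue_stieltjes_measure v `]a, b[ < +oo)%E.
  rewrite (@le_lt_trans _ _ (lebesgue_stieltjes_measure v `]a, b]))//.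
    apply: le_measure; rewrite ?inE//; exact: subset_itv_oo_oc.
  by rewrite stieltjes_itv ?ltry// ltW.
pose nu : {finite_measure set (measurableTypeR R) -> \bar R} :=
  @mfrestr _ (measurableTypeR R) R _ (lebesgue_stieltjes_measure v)
    (measurable_itv `]a, b[) moo.
have [f [_ ffin fint fE]] := @radon_nikodym_sigma_finite _ _ _ mu nu
  (stieltjes_itv_dominated moo vac).
pose g := fine \o f.
have gf : EFin \o g = f by apply/funext => x; rewrite /= fineK.
have gint : mu.-integrable setT (EFin \o g) by rewrite gf.
have gintNy y : mu.-integrable `]-oo, y] (EFin \o g).
  by apply: integrableS gint => //; exact: measurable_itv.
have := @FTC1Ny R g gintNy (open_integrable_locally openT gint).
apply: filterS; first exact: (ae_filter_ringOfSetsType mu).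
move=> x [dF _] /andP[ax xb].
have FE y : a < y < b ->
    (\int[mu]_(t in `]-oo, y]) g t)%R = v y - v a.
  move=> /andP[ay yb]; rewrite /Rintegral.
  have -> : (\int[mu]_(t in `]-oo, y]) (g t)%:E = \int[mu]_(t in `]-oo, y]) f t)%E.
    by apply: eq_integral => t _; rewrite -gf.
  rewrite -fE//= /nu/= /mfrestr/= /mrestr.
  have -> : `]-oo, y] `&` `]a, b[ = `]a, y]%classic.
    apply/seteqP; split => t /=; rewrite !in_itv/=.
      by move=> [-> /andP[->]].
    by move=> /andP[-> ty]; split => //=; exact: le_lt_trans yb.
  by rewrite stieltjes_itv// ltW.
have := derivableD dF (derivable_cst (v a) x 1).
apply: near_eq_derivable; near=> y; rewrite addrfctE FE ?subrK//.
have : y \in `]a, b[ by near: y; apply: near_in_itvoo; rewrite in_itv/= ax.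
by rewrite in_itv.
Unshelve. all: by end_near. Qed.

End ac_cumulative.

Section ac_derivable.
Context {R : realType}.
Implicit Types (a b : R) (f : R -> R).
Local Notation mu := (@lebesgue_measure R).

(** A Stieltjes measure is defined by a function on the whole line: f is extended
by constants outside [a, b]. *)
Lemma nondecreasing_ac_derivable f a b :
  {in `[a, b] &, {homo f : x y / x <= y}} -> ac_family a b f ->
  {ae mu, forall x, a < x < b -> derivable f x 1}.
Proof.
move=> fnd fac; have [ab|ba] := ltP a b; last first.
  by apply: aeW => x /andP[ax xb]; move: (lt_trans ax xb); rewrite ltNge ba.
pose c x := Num.max a (Num.min x b).
have cE x : a <= x -> x <= b -> c x = x.
  by move=> ax xb; rewrite /c (min_idPl xb) (max_idPr ax).
have cab x : c x \in `[a, b].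
  by rewrite in_itv/= /c le_max lexx/= ge_max (ltW ab)/= ge_min lexx orbT.
have cnd x y : x <= y -> c x <= c y.
  by move=> xy; rewrite /c ge_max !le_max lexx/= le_min !ge_min lexx xy !orbT.
have gnd : {homo f \o c : x y / x <= y}.
  by move=> x y xy /=; apply: fnd => //; exact: cnd.
have grc : right_continuous (f \o c).
  move=> x /=; have [xa|ax] := ltP x a.
    rewrite (_ : c x = a); last first.
      by rewrite /c (min_idPl _) ?(max_idPl _)// ?ltW// (lt_trans xa).
    apply: cvg_near_cst; near=> t; congr f; apply/max_idPl.
    rewrite ge_min; apply/orP; left; near: t; exact: nbhs_right_le.
  have [xb|bx] := ltP x b; last first.
    apply: cvg_near_cst; near=> t; congr f.
    rewrite /c !(min_idPr _)//; near: t; apply: filterS (nbhs_right_ge x) => t.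
    exact: le_trans.
  rewrite cE ?(ltW xb)//.
  apply: cvg_trans (ac_family_right_continuous ax xb fac).
  apply: near_eq_cvg; near=> t; rewrite /= cE//.
    by rewrite (le_trans ax)//; near: t; exact: nbhs_right_ge.
  by near: t; exact: nbhs_right_le.
pose mc := isCumulative.Build R _ R (f \o c) gnd grc.
pose g : cumulative R R := HB.pack (f \o c) mc.
have gE x : a <= x -> x <= b -> g x = f x by move=> ax xb; rewrite /g/= cE.
have gac : ac_family a b g.
  move=> e /fac[d d0 fd]; exists d => // l lab ld.
  rewrite (_ : \sum_(p <- l) _ = \sum_(p <- l) `|f p.2 - f p.1|); first exact: fd.
  case/andP: lab => /allP lab _; rewrite big_seq [RHS]big_seq.
  apply: eq_bigr => p /lab/and3P[ap pp pb].
  by rewrite !gE// ?(le_trans ap)// ?ltW// ?(lt_le_trans pp).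
have := ac_cumulative_derivable gac.
apply: filterS; first exact: (ae_filter_ringOfSetsType mu).
move=> x dg xab; have := dg xab; apply: near_eq_derivable.
have : x \in `]a, b[ by rewrite in_itv.
move=> /near_in_itvoo; apply: filterS => y; rewrite in_itv/= => /andP[ay yb].
by apply: gE; exact: ltW.
Unshelve. all: by end_near. Qed.

Lemma ac_familyB a b f g : ac_family a b f -> ac_family a b g ->
  ac_family a b (f \- g).
Proof.
move=> fac gac e e0; have e2 : 0 < e / 2 by rewrite divr_gt0.
have [d d0 fd] := fac _ e2; have [d' d'0 gd] := gac _ e2.
exists (Num.min d d'); first by rewrite lt_min d0.
move=> l lab; rewrite lt_min => /andP[/(fd _ lab) fl /(gd _ lab) gl].
rewrite (splitr e); apply: le_lt_trans (ltrD fl gl).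
rewrite -big_split/=; apply: ler_sum => p _.
rewrite [X in `|X|](_ : _ = (f p.2 - f p.1) - (g p.2 - g p.1)) ?ler_normB//=.
by ring.
Qed.

(** f is the difference of T, its variation from a, and of T - f; both are
nondecreasing and absolutely continuous. *)
Lemma ac_family_derivable f a b : ac_family a b f ->
  {ae mu, forall x, a < x < b -> derivable f x 1}.
Proof.
move=> fac; have [ab|ba] := ltP a b; last first.
  by apply: aeW => x /andP[ax xb]; move: (lt_trans ax xb); rewrite ltNge ba.
pose T x := fine (total_variation a x f).
have fbv := ac_family_bounded_variation (ltW ab) fac.
have fin x y : a <= x -> x <= y -> y <= b -> total_variation x y f \is a fin_num.
  move=> ax xy yb; apply/bounded_variationP => //.
  exact/(bounded_variationl xy yb)/(bounded_variationr ax (le_trans xy yb)).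
have TB x y : a <= x -> x <= y -> y <= b ->
    T y - T x = fine (total_variation x y f).
  move=> ax xy yb; rewrite /T (total_variationD f ax xy) fineD ?fin//.
    by rewrite addrAC subrr add0r.
  exact: le_trans yb.
have Tac : ac_family a b T.
  move=> e e0; have e2 : 0 < e / 2 by rewrite divr_gt0.
  have [d d0 fd] := ac_family_total_variation fac e2.
  exists d => // l lab /(fd _ lab) le_e.
  apply: (@le_lt_trans _ _ (e / 2)); last by lra.
  rewrite -lee_fin -sumEFin; apply: le_trans le_e.
  case/andP: lab => /allP lab _; rewrite big_seq [leRHS]big_seq.
  apply: lee_sum => p /lab/and3P[ap /ltW pp pb].
  rewrite TB// ger0_norm ?fineK ?fin//.
  by rewrite fine_ge0// total_variation_ge0.
have Tnd : {in `[a, b] &, {homo T : x y / x <= y}}.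
  move=> x y; rewrite !in_itv/= => /andP[ax xb] /andP[ay yb] xy.
  by rewrite -subr_ge0 TB// fine_ge0// total_variation_ge0.
have Nnd : {in `[a, b] &, {homo T \- f : x y / x <= y}}.
  move=> x y; rewrite !in_itv/= => /andP[ax xb] /andP[ay yb] xy.
  suff : f y - f x <= T y - T x by lra.
  rewrite TB// -lee_fin fineK ?fin// (le_trans _ (total_variation_ge _ xy))//.
  by rewrite lee_fin ler_norm.
have := nondecreasing_ac_derivable Nnd (ac_familyB Tac fac).
have := nondecreasing_ac_derivable Tnd Tac.
apply: filterS2; first exact: (ae_filter_ringOfSetsType mu).
move=> x dT dN xab.
have -> : f = T \- (T \- f) by apply/funext => y /=; rewrite subKr.
by apply: derivableB; [exact: dT|exact: dN].
Qed.

Lemma absolutely_continuous_on_coord n (u : R -> 'rV[R]_n.+1) a b i :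
  absolutely_continuous_on a b u -> ac_family a b (fun t => u t 0 i).
Proof.
move=> uac; apply: absolutely_continuous_on_family => e /uac[d d0 ud].
exists d => // m s t st tI std; apply: le_lt_trans (ud m s t st tI std).
apply: ler_sum => k _; apply: le_trans (row_norm_ge _ i); by rewrite !mxE.
Qed.

Theorem absolutely_continuous_derivable n (u : R -> 'rV[R]_n.+1) a b :
  absolutely_continuous_on a b u ->
  {ae mu, forall t, a < t < b -> derivable u t 1}.
Proof.
move=> uac.
have D i := ac_family_derivable (absolutely_continuous_on_coord i uac).
have : {ae mu, forall t, forall i, a < t < b -> derivable (fun t => u t 0 i) t 1}.
  apply: filter_forall; exact: D.
apply: filterS; first exact: (ae_filter_ringOfSetsType mu).
by move=> t dt tab; apply/derivable_mxP => i j; rewrite (ord1 i); exact: dt.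
Qed.

End ac_derivable.

(** * Velocity on preimages of null sets *)

Section null_preimage.
Context {R : realType}.
Implicit Types (A N : set R) (w : R -> R).
Local Notation mu := (@lebesgue_measure R).

Lemma negligible_itv_cover N e : mu.-negligible N -> 0 < e ->
  exists c : nat -> R * R, [/\ forall k, (c k).1 <= (c k).2,
    N `<=` \bigcup_k `](c k).1, (c k).2[%classic &
    (\sum_(k <oo) ((c k).2 - (c k).1)%:E <= e%:E)%E].
Proof.
move=> /negligible_outer_measure N0 e0.
have : (ereal_inf [set \sum_(k <oo) wlength idfun (I k) |
    I in open_itv_cover N] < e%:E)%E.
  by rewrite -outer_measure_open_itv_cover N0 lte_fin.
move=> /ereal_inf_lt[_ [I [+ NI] <-] Ie].
move=> /choice[c Ic].
(* empty intervals are normalized so that all lengths are nonnegative *)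
pose c' k := if (c k).1 < (c k).2 then c k else (0, 0).
have IE k : I k = `](c' k).1, (c' k).2[%classic.
  rewrite /c'; case: ifPn => //; rewrite -leNgt => c21.
  by rewrite Ic !set_itv_ge// bnd_simp -leNgt.
have c'le k : (c' k).1 <= (c' k).2 by rewrite /c'; case: ifPn => // /ltW.
exists c'; split => //.
  by apply: subset_trans NI _; apply: subset_bigcup => k _; rewrite IE.
apply: le_trans (ltW Ie); apply: lee_nneseries => [k _ _|k _].
  by rewrite lee_fin subr_ge0.
by rewrite IE wlength_itv_bnd.
Qed.

(** The part of A sent into an interval of length l has diameter at most K * l, so
a cover of N by short intervals gives a cover of A by intervals at most 2 * K
times as long. *)
Lemma negligible_expanding_preimage A N w K : 0 <= K ->
  {in A &, forall s t, `|s - t| <= K * `|w s - w t|} ->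
  w @` A `<=` N -> mu.-negligible N -> mu.-negligible A.
Proof.
move=> K0 wK wN N0; apply/negligible_outer_measure.
apply/eqP; rewrite eq_le outer_measure_ge0 andbT.
apply/lee_addgt0Pr => e e0; rewrite add0e.
have K1 : 0 < 2 * (K + 1) by lra.
have [c [cle Nc ce]] := negligible_itv_cover N0 (divr_gt0 e0 K1).
pose P k t := A t /\ (c k).1 < w t < (c k).2.
pose t_ k := xget 0 (P k).
pose r k := K * ((c k).2 - (c k).1).
have r0 k : 0 <= r k by rewrite mulr_ge0// subr_ge0.
pose J k := `[t_ k - r k, t_ k + r k]%classic.
(* t_ k is an arbitrary point of A sent into the interval c k, and 0 if there is
   none *)
have AJ : A `<=` \bigcup_k J k.
  move=> t At; have [|k _ /=] := Nc (w t); first by apply: wN; exists t.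
  rewrite in_itv/= => wt; exists k => //=.
  have [At_ wt_] : P k (t_ k) by apply: xgetPex; exists t.
  suff : `|t - t_ k| <= r k by rewrite /J/= in_itv/= ler_distl.
  apply: le_trans (wK _ _ (mem_set At) (mem_set At_)) _.
  rewrite ler_wpM2l// ler_norml; move: wt wt_ => /andP[? ?] /andP[? ?].
  by apply/andP; split; rewrite /t_; lra.
apply: le_trans (le_outer_measure ((wlength idfun)^*)%mu _ _ AJ) _.
apply: le_trans (outer_measure_sigma_subadditive _ _) _.
have JE k : ((wlength idfun)^* (J k))%mu =
    ((2 * K)%:E * ((c k).2 - (c k).1)%:E)%E.
  have := @lebesgue_measure_itv R `[t_ k - r k, t_ k + r k].
  rewrite /lebesgue_measure/= /lebesgue_stieltjes_measure/= /measure_extension.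
  move=> ->; rewrite /= lte_fin; case: ltP => tr.
    by rewrite -EFinB -EFinM /r; congr EFin; ring.
  rewrite -EFinM (_ : 2 * K * _ = 2 * r k); last by rewrite /r mulrA.
  have := r0 k; rewrite le_eqVlt => /predU1P[<-|rk]; first by rewrite mulr0.
  by exfalso; lra.
apply: (@le_trans _ _ (\sum_(k <oo) ((2 * K)%:E * ((c k).2 - (c k).1)%:E))%E).
  apply: lee_nneseries => [k _ _|k _]; first exact: outer_measure_ge0.
  by rewrite -JE.
rewrite nneseriesZl//; last by move=> k _; rewrite lee_fin subr_ge0.
apply: le_trans (lee_wpmul2l _ ce) _; first by rewrite lee_fin; lra.
rewrite -EFinM lee_fin mulrA ler_pdivrMr// [leLHS]mulrC ler_pM2l//; lra.
Qed.

(** Where the derivative is nonzero, w expands distances from t, by a factor and on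
a scale that can both be taken of the form 1/k.  The exceptional set is thus a
countable union of pieces of small diameter on which w is expanding. *)
Lemma derive_null_preimage w N : mu.-negligible N ->
  {ae mu, forall t, N (w t) -> derivable w t 1 -> 'D_1 w t = 0}.
Proof.
move=> N0.
change (mu.-negligible (~` [set t | N (w t) -> derivable w t 1 -> 'D_1 w t = 0])).
(* E k n: the points of the interval [z n / k.+1, (z n + 1) / k.+1[ that work
   with the constant k.+1, for an enumeration z of the integers *)
pose z n : int := odflt 0 (unpickle n).
pose E k n := [set t : R | [/\ N (w t),
  forall s, `|s - t| < k.+1%:R^-1 -> `|s - t| <= k.+1%:R * `|w s - w t| &
  (z n)%:~R <= t * k.+1%:R < (z n)%:~R + 1]].
apply: (@negligibleS _ _ _ mu (\bigcup_k \bigcup_n E k n)); last first.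
  apply: negligible_bigcup => k; apply: negligible_bigcup => n.
  apply: (@negligible_expanding_preimage _ N w k.+1%:R) => //.
    move=> s t /set_mem[_ _ /andP[s1 s2]] /set_mem[_ st /andP[t1 t2]].
    apply: st; rewrite -[ltRHS]mul1r ltr_pdivlMr// -[X in _ * X]ger0_norm//.
    by rewrite -normrM ltr_norml; apply/andP; split; lra.
  by move=> _ [t [Nt _ _] <-].
move=> t /= /not_implyP[Nt /not_implyP[dt /eqP D0]].
have D0' : 0 < `|'D_1 w t| / 2 by rewrite divr_gt0 ?normr_gt0.
have D1 : `|'D_1 w t| / 2 < `|'D_1 w t| by lra.
have [d /= d0 dP] := cvgr_gt _ (cvg_norm dt) _ D1.
have m0 : 0 < Num.min d (`|'D_1 w t| / 2) by rewrite lt_min d0.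
have [k] : exists k, k.+1%:R^-1 < Num.min d (`|'D_1 w t| / 2).
  near \oo => k; exists k; near: k; exact: near_infty_natSinv_lt (PosNum m0).
rewrite lt_min => /andP[kd kD]; exists k => //.
have [n nE] : exists n, z n = Num.floor (t * k.+1%:R).
  by exists (pickle (Num.floor (t * k.+1%:R))); rewrite /z pickleK.
exists n => //; split=> // [s st|]; last first.
  by have := floor_itv (t * k.+1%:R); rewrite nE intrD.
have [->|st0] := eqVneq s t; first by rewrite !subrr !normr0 mulr0.
have := dP (s - t).
rewrite /= sub0r normrN subr_eq0 (lt_trans st kd) => /(_ isT st0).
rewrite /= [_ *: 1]mulr1 subrK normrM normfV => h.
have st1 : 0 < `|s - t| by rewrite normr_gt0 subr_eq0.
by move: (lt_trans kD h); rewrite ltr_pdivlMl// ltr_pdivrMr// mulrC => /ltW.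
Unshelve. all: by end_near. Qed.

End null_preimage.

Section null_frame.
Context {R : realType}.
Local Notation mu := (@lebesgue_measure R).

Lemma is_derive_dot n (u : R -> 'rV[R]_n.+1) (e : 'rV[R]_n.+1) t :
  derivable u t 1 -> is_derive t 1 (fun s => dot (u s) e) (dot ('D_1 u t) e).
Proof.
move=> du; have dui := (derivable_mxP _ _ _).1 du.
have -> : (fun s => dot (u s) e) =
    \sum_(i < n.+1) (fun s => u s 0 i * e 0 i).
  by apply/funext => s; rewrite fct_sumE.
apply: is_derive_eq.
  apply: is_derive_sum => i.
  exact: (is_deriveM (derivableP (dui 0 i)) (is_derive_cst (e 0 i) t 1)).
apply: eq_bigr => i _; rewrite scaler0 add0r derive_mx// mxE.
by rewrite [LHS]mulrC.
Qed.

Lemma orthonormal_dot0 (e1 e2 v : 'rV[R]_2) :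
  dot e1 e1 = 1 -> dot e2 e2 = 1 -> dot e1 e2 = 0 ->
  dot v e1 = 0 -> dot v e2 = 0 -> v = 0.
Proof.
rewrite /dot !big_ord_recl !big_ord0 !addr0.
set j : 'I_2 := lift _ _.
move: (e1 0 0) (e1 0 j) (e2 0 0) (e2 0 j) => a b c d n1 n2 n12 v1 v2.
(* Lagrange's identity for the determinant of the frame *)
have dt : (a * d - b * c) ^+ 2 = 1.
  rewrite (_ : _ ^+ 2 = (a * a + b * b) * (c * c + d * d) - (a * c + b * d) ^+ 2).
    by rewrite n1 n2 n12; ring.
  by ring.
have dt0 : a * d - b * c != 0.
  by apply/eqP => h; move/eqP: dt; rewrite h expr0n/= eq_sym oner_eq0.
have x0 : v 0 0 = 0.
  apply: (mulfI dt0); rewrite mulr0.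
  transitivity (d * (v 0 0 * a + v 0 j * b) - b * (v 0 0 * c + v 0 j * d)).
    by ring.
  by rewrite v1 v2; ring.
have y0 : v 0 j = 0.
  apply: (mulfI dt0); rewrite mulr0.
  transitivity (a * (v 0 0 * c + v 0 j * d) - c * (v 0 0 * a + v 0 j * b)).
    by ring.
  by rewrite v1 v2; ring.
apply/rowP => i; rewrite mxE; have [->|->//] : i = 0 \/ i = j; last exact: x0.
by case: i => -[|[|//]] ?; [left|right]; apply/val_inj.
Qed.

(** While u is in S each coordinate of u in the frame lies in a null set, so that
the velocity is almost everywhere orthogonal to both e1 and e2. *)
Lemma null_frame_velocity (S : set 'rV[R]_2) (e1 e2 : 'rV[R]_2) :
  dot e1 e1 = 1 -> dot e2 e2 = 1 -> dot e1 e2 = 0 ->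
  (forall e, e = e1 \/ e = e2 -> mu [set dot z e | z in S] = 0%E) ->
  forall u : R -> 'rV[R]_2, absolutely_continuous_on 0 1 u ->
  {ae mu, forall t, 0 < t < 1 -> S (u t) -> 'D_1 u t = 0}.
Proof.
move=> n1 n2 n12 null u uac.
have null' e : e = e1 \/ e = e2 -> {ae mu, forall t,
    [set dot z e | z in S] (dot (u t) e) ->
    derivable (fun s => dot (u s) e) t 1 -> 'D_1 (fun s => dot (u s) e) t = 0}.
  by move=> /null N0; apply: derive_null_preimage; apply/negligible_outer_measure.
have aeF := ae_filter_ringOfSetsType mu.
apply: (@filterS3 _ _ aeF) (absolutely_continuous_derivable uac)
  (null' _ (or_introl erefl)) (null' _ (or_intror erefl)) => t du d1 d2 t01 St.
have dut := du t01.
apply: (orthonormal_dot0 n1 n2 n12).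
  have [de <-] := is_derive_dot e1 dut.
  by apply: d1 => //; exists (u t).
have [de <-] := is_derive_dot e2 dut.
by apply: d2 => //; exists (u t).
Qed.

End null_frame.

(** * Gradients and path differentiability *)

Section gradients.
Context {R : realType} {n : nat}.
Implicit Types (phi : 'rV[R]_n.+1 -> R) (x y v : 'rV[R]_n.+1).

Lemma dot_norm_le x y : `|dot x y| <= n.+1%:R * `|x| * `|y|.
Proof.
apply: le_trans (ler_norm_sum _ _ _) _.
apply: (@le_trans _ _ (\sum_(i < n.+1) `|x| * `|y|)).
  by apply: ler_sum => i _; rewrite normrM ler_pM ?row_norm_ge.
by rewrite sumr_const card_ord -[leLHS]mulr_natl mulrA.
Qed.

Lemma diff_gradient phi x v : differentiable phi x ->
  'd phi x v = dot v (gradient phi x).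
Proof.
move=> dphi; rewrite {1}(row_sum_delta v) linear_sum; apply: eq_bigr => i _.
by rewrite linearZ/= mxE deriveE.
Qed.

Lemma derive_along phi (u : R -> 'rV[R]_n.+1) t :
  derivable u t 1 -> differentiable phi (u t) ->
  is_derive t 1 (phi \o u) (dot ('D_1 u t) (gradient phi (u t))).
Proof.
move=> /derivable1_diffP du dphi.
have dpu : differentiable (phi \o u) t by exact: differentiable_comp.
apply: DeriveDef; first exact: diff_derivable.
by rewrite deriveE// diff_comp//= diff_gradient// deriveE.
Qed.

(** The mean value theorem along the segment from x to y. *)
Lemma gradient_bounded_lipschitz phi (L : R) x y :
  (forall z, differentiable phi z) -> (forall z, `|gradient phi z| <= L) ->
  `|phi y - phi x| <= n.+1%:R * L * `|y - x|.
Proof.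
move=> dphi phiL; pose u (s : R) := x + s *: (y - x).
have du (s : R) : is_derive s 1 u (y - x).
  rewrite -[X in is_derive _ _ _ X]add0r; apply: is_deriveD.
  have [ds dsE] := is_diff_scalel s (y - x).
  apply: DeriveDef; first exact: diff_derivable.
  by rewrite deriveE// dsE scale1r.
have dpu (s : R) := derive_along (ex_derive (is_derive := du s)) (dphi (u s)).
have [||s _] := @MVT R (phi \o u) (fun s => dot (y - x) (gradient phi (u s))) 0 1 ltr01.
  by move=> s _; have := dpu s; rewrite derive_val.
  apply: derivable_within_continuous => s _; exact: ex_derive.
rewrite /= /u scale0r addr0 scale1r [x + _]addrC subrK subr0 mulr1 => ->.
apply: le_trans (dot_norm_le _ _) _; rewrite mulrAC.
by rewrite ler_wpM2r// ler_wpM2l.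
Qed.

Lemma gradient_bounded_locally_lipschitz phi (L : R) :
  (forall z, differentiable phi z) -> (forall z, `|gradient phi z| <= L) ->
  locally_lipschitz phi.
Proof.
move=> dphi phiL x; exists setT; first exact: filterT.
apply: (@klipschitzW _ _ _ (n.+1%:R * L)); last move=> [y z] _ /=.
  exact: (@globally_properfilter _ _ (x, x)).
exact: gradient_bounded_lipschitz.
Qed.

End gradients.

Section path_differentiability.
Context {R : realType} {n : nat}.
Local Notation mu := (@lebesgue_measure R).

(** The conservative field is the gradient off S, and the whole ball of radius L at
the points of S: this keeps the graph closed, and the chain rule holds at these
points because the velocity of the curve is zero there. *)
Lemma path_differentiable_off_null (S : set 'rV[R]_n.+1) (phi : 'rV[R]_n.+1 -> R)
    (L : R) :
  closed S -> (forall z, differentiable phi z) ->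
  (forall z, `|gradient phi z| <= L) ->
  (forall z, ~ S z -> {for z, continuous (gradient phi)}) ->
  (forall u : R -> 'rV[R]_n.+1, absolutely_continuous_on 0 1 u ->
    {ae mu, forall t, 0 < t < 1 -> S (u t) -> 'D_1 u t = 0}) ->
  path_differentiable phi.
Proof.
move=> cS dphi phiL cphi null; split.
  exact: gradient_bounded_locally_lipschitz phiL.
pose D z := [set v | `|v| <= L /\ (~ S z -> v = gradient phi z)].
exists D; split.
- by move=> z; exists (gradient phi z).
- move=> z; exists setT; first exact: filterT.
  exists L; split; first exact: num_real.
  by move=> M LM v [w _ [+ _]] => /le_trans; apply; exact: ltW.
- rewrite -openC openE => -[z v] /= nDzv; rewrite /interior/=.
  have [vL|Lv] := leP `|v| L; last first.
    have : \forall p \near (z, v), L < `|p.2|.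
      have : (fun p : 'rV[R]_n.+1 * 'rV[R]_n.+1 => `|p.2|) @ (z, v) --> `|v|.
        by apply: cvg_norm; exact: cvg_snd.
      by move=> /cvgr_gt; apply.
    by apply: filterS => -[z' v'] /= Lv' []; rewrite leNgt Lv'.
  have /not_implyP[Sz vE] : ~ (~ S z -> v = gradient phi z).
    by move=> vE; exact: nDzv.
  have vz : v - gradient phi z != 0.
    by apply/eqP => /subr0_eq.
  have : \forall p \near (z, v), p.2 - gradient phi p.1 != 0.
    have : (fun p : 'rV[R]_n.+1 * 'rV[R]_n.+1 => p.2 - gradient phi p.1)
        @ (z, v) --> v - gradient phi z.
      apply: cvgB; first exact: cvg_snd.
      by apply: (@cvg_comp _ _ _ fst (gradient phi) _ (nbhs z)) (cphi z Sz);
        exact: cvg_fst.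
    by move=> /cvgr_neq0; apply.
  have : \forall p \near (z, v), ~ S p.1.
    have : \forall z' \near z, (~` S) z'.
      by apply: open_nbhs_nbhs; split => //; exact: closed_openC.
    by move=> nS; apply: cvg_fst nS.
  by apply: filterS2 => -[z' v'] /= Sz' /eqP + [_ /(_ Sz') v'E]; rewrite v'E subrr.
- move=> u uac.
  have : {ae mu, forall t, t != 0 /\ t != 1}.
    change (mu.-negligible (~` [set t : R | t != 0 /\ t != 1])).
    apply: (@negligibleS _ _ _ mu ([set 0] `|` [set 1])).
      by move=> t /= /not_andP[/negP/negPn/eqP|/negP/negPn/eqP]; [left|right].
    by apply: negligibleU; apply/negligibleP => //; exact: lebesgue_measure_set1.
  have := null u uac; have := absolutely_continuous_derivable uac.
  have aeF := ae_filter_ringOfSetsType mu.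
  apply: (@filterS3 _ _ aeF) => t du dS [t0 t1] /andP[t0' t1'].
  have t01 : 0 < t < 1 by rewrite !lt_neqAle eq_sym t0 t1 t0' t1'.
  have dut := du t01; have dpu := derive_along dut (dphi (u t)).
  split; [exact: dut|by case: dpu|].
  move=> v [_ vE]; rewrite (@derive_val _ _ _ _ _ _ _ dpu).
  have [Sut|/vE ->//] := pselect (S (u t)).
  by rewrite dS// /dot !big1// => i _; rewrite mxE mul0r.
Qed.

End path_differentiability.

(** * Differential calculus in the plane *)

Section quadratic_flatness.
Context {R : realType}.

(** This differentiates the square of the positive part and the sum of bumps at the
points of S, and, with K = 0, a function that is only locally equal to a
differentiable one. *)
Lemma quadratic_is_diff (V : normedModType R) (f : V -> R) z (K : R) :
  (\forall y \near z, `|f y - f z| <= K * `|y - z| ^+ 2) -> is_diff z f 0.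
Proof.
move=> fK.
have fo : f \o shift z = cst (f z) + \0 +o_ (0 : V) id.
  apply/eqaddoP => e e0.
  pose M := Num.max K 1; have M0 : 0 < M by rewrite lt_max ltr01 orbT.
  have fK0 : \forall h \near (0 : V), `|f (h + z) - f z| <= K * `|h| ^+ 2.
    have hz : (fun h : V => h + z) @ (0 : V) --> z.
      by rewrite -[X in _ --> X]add0r; apply: cvgD; [exact: cvg_id|exact: cvg_cst].
    have : \forall h \near (0 : V), `|f (h + z) - f z| <= K * `|h + z - z| ^+ 2.
      exact: hz _ fK.
    by apply: filterS => h /=; rewrite addrK.
  near=> h; rewrite /= fctE/= addr0.
  have hK : `|f (h + z) - f z| <= K * `|h| ^+ 2 by near: h.
  have he : `|h| <= e / M.
    by near: h; apply: nbhs0_le; rewrite divr_gt0.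
  apply: le_trans hK _; rewrite expr2 mulrA ler_wpM2r//.
  apply: (@le_trans _ _ (M * `|h|)); first by rewrite ler_wpM2r// le_max lexx.
  by rewrite mulrC -ler_pdivlMr.
have dE : 'd f z = \0 :> (V -> R).
  by apply: diff_unique => //; exact: cst_continuous.
apply: DiffDef => //; apply/diff_locallyP; rewrite dE; split => //.
exact: cst_continuous.
Unshelve. all: by end_near. Qed.

End quadratic_flatness.

Section local_equality.
Context {R : realType} {n : nat}.
Implicit Types (f g : 'rV[R]_n -> R) (z : 'rV[R]_n).

Lemma near_eq_differentiable f g z :
  (\forall y \near z, f y = g y) -> differentiable g z -> differentiable f z.
Proof.
move=> fg dg; have -> : f = (f - g) + g by rewrite subrK.
apply: differentiableD => //.
have [//] : is_diff z (f - g) 0.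
apply: (@quadratic_is_diff _ _ _ _ 0).
have fgz := nbhs_singleton fg; apply: filterS fg => y fgy.
by rewrite !fctE fgy fgz !subrr normr0 mul0r.
Qed.

Lemma near_eq_gradient f g z :
  (\forall y \near z, f y = g y) -> gradient f z = gradient g z.
Proof. by move=> fg; apply/rowP => i; rewrite !mxE; exact: near_eq_derive. Qed.

Lemma gradientD f g z : differentiable f z -> differentiable g z ->
  gradient (f + g) z = gradient f z + gradient g z.
Proof.
by move=> df dg; apply/rowP => i; rewrite !mxE deriveD//; exact: diff_derivable.
Qed.

End local_equality.

Section separable.
Context {R : realType}.
Implicit Types (z : 'rV[R]_2) (g h : R -> R).

Lemma derive_coord z (v : 'rV[R]_2) i : 'D_v (fun y : 'rV[R]_2 => y 0 i) z = v 0 i.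
Proof.
have := derive_mx (@derivable_id _ _ z v); rewrite derive_id.
by move/rowP/(_ i); rewrite mxE.
Qed.

Lemma is_derive_comp_coord g (dg : R) z (v : 'rV[R]_2) i :
  is_derive (z 0 i) 1 g dg ->
  differentiable (fun y : 'rV[R]_2 => g (y 0 i)) z /\
  'D_v (fun y : 'rV[R]_2 => g (y 0 i)) z = v 0 i * dg.
Proof.
move=> [dgz <-]; have dc := differentiable_coord z 0 i.
have dg' : differentiable g (z 0 i) by exact/derivable1_diffP.
have dcomp := differentiable_comp dc dg'.
split => //; rewrite deriveE// diff_comp//= deriv1E// derive1E.
by rewrite -deriveE// derive_coord.
Qed.

(** The bumps and the sine term are both products of a function of the first
coordinate and of a function of the second one. *)
Lemma separable_gradient g h (dg dh : R) z :
  is_derive (z 0 0) 1 g dg -> is_derive (z 0 1) 1 h dh ->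
  differentiable (fun y : 'rV[R]_2 => g (y 0 0) * h (y 0 1)) z /\
  gradient (fun y : 'rV[R]_2 => g (y 0 0) * h (y 0 1)) z =
    pt (dg * h (z 0 1)) (g (z 0 0) * dh).
Proof.
move=> gz hz; split.
  by apply: differentiableM; apply: (is_derive_comp_coord 0 _).1.
apply/rowP => i; rewrite !mxE.
have [dg0 dgE] := is_derive_comp_coord (delta_mx 0 i) gz.
have [dh0 dhE] := is_derive_comp_coord (delta_mx 0 i) hz.
rewrite deriveM; [|exact: diff_derivable|exact: diff_derivable].
rewrite dgE dhE.
move: i {dg0 dgE dh0 dhE}; apply: rV2P; rewrite !mxE/=.
  by rewrite mul0r mul1r scaler0 add0r [LHS]mulrC.
by rewrite mul0r mul1r scaler0 addr0.
Qed.

Definition sine2 (z : 'rV[R]_2) : R := sin (z 0 1).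

Lemma sine2_gradient z :
  differentiable sine2 z /\ gradient sine2 z = pt 0 (cos (z 0 1)).
Proof.
have [] := separable_gradient (is_derive_cst (1 : R) (z 0 0) 1) (is_derive_sin (z 0 1)).
rewrite (_ : (fun y : 'rV[R]_2 => _) = sine2) ?mul0r ?mul1r//.
by apply/funext => y; rewrite mul1r.
Qed.

Lemma sine2_gradient_cvg (T : Type) (F : set_system T) {FF : Filter F}
    (u : T -> 'rV[R]_2) (z : 'rV[R]_2) : u @ F --> z ->
  (fun k => gradient sine2 (u k)) @ F --> pt 0 (cos (z 0 1)).
Proof.
move=> uz; rewrite (_ : (fun k => _) = (fun k => pt 0 (cos (u k 0 1)))).
  apply: cvg_pt; first exact: cvg_cst.
  have u1 : (fun k => u k 0 1) @ F --> z 0 1.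
    exact: cvg_comp uz (@coord_continuous R 1 2 0 1 z).
  exact: cvg_comp u1 (@continuous_cos R (z 0 1)).
by apply/funext => k; rewrite (sine2_gradient _).2.
Qed.

End separable.

(** * Bumps *)

Section bump_profile.
Context {R : realType}.
Implicit Types (s x y : R).

(** The square makes the profile continuously differentiable at -1 and 1. *)
Definition bump1 s : R := Num.max 0 (1 - s ^+ 2) ^+ 2.
Definition dbump1 s : R := - (4 * s) * Num.max 0 (1 - s ^+ 2).

Lemma is_derive_pos_sqr y :
  is_derive y 1 (fun x : R => Num.max 0 x ^+ 2) (2 * Num.max 0 y).
Proof.
set c := 2 * _.
have [dg dgE] : is_diff y (fun x : R => Num.max 0 x ^+ 2 - c * x) 0.
  apply: (@quadratic_is_diff _ R _ _ 1); near=> x.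
  rewrite mul1r real_normK ?num_real// ler_norml /c.
  have sq := sqr_ge0 (x - y); have sqx := sqr_ge0 x; have sqy := sqr_ge0 y.
  case: (leP 0 x) => x0; case: (leP 0 y) => y0; rewrite ?expr0n /=.
  - by apply/andP; split; nra.
  - by have xy : 0 <= x * - y by [rewrite mulr_ge0// oppr_ge0 ltW];
      apply/andP; split; nra.
  - by have xy : 0 <= y * - x by [rewrite mulr_ge0// oppr_ge0 ltW];
      apply/andP; split; nra.
  - by apply/andP; split; nra.
have dg0 : is_derive y 1 (fun x : R => Num.max 0 x ^+ 2 - c * x) 0.
  by apply: DeriveDef; [exact: diff_derivable|rewrite deriveE// dgE].
have := is_deriveD dg0 (is_deriveZ c (is_derive_id y 1)).
rewrite add0r [_ *: _]mulr1; congr (is_derive _ _ _ _).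
by apply/funext => x; rewrite addrfctE /= [_ *: _]/(c * x) subrK.
Unshelve. all: by end_near. Qed.

Lemma is_derive_bump1 s : is_derive s 1 bump1 (dbump1 s).
Proof.
have h : is_derive s 1 (fun x : R => 1 - x ^+ 2) (- (2 * s)).
  have := is_deriveB (is_derive_cst (1 : R) s 1) (is_deriveX 2 (is_derive_id s 1)).
  by rewrite sub0r [_ *: _]mulr1 expr1.
have := @is_derive1_comp _ _ (fun x : R => 1 - x ^+ 2) s _ _
  (is_derive_pos_sqr (1 - s ^+ 2)) h.
by rewrite (_ : _ * _ = dbump1 s)// /dbump1; ring.
Qed.

Lemma bump1_ge0 s : 0 <= bump1 s. Proof. exact: sqr_ge0. Qed.

Lemma bump1_le1 s : bump1 s <= 1.
Proof.
by rewrite /bump1 expr_le1 ?le_max ?lexx// ge_max ler01/= lerBlDl lerDr sqr_ge0.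
Qed.

Lemma bump1_neq0 s : bump1 s != 0 -> `|s| < 1.
Proof.
rewrite sqrf_eq0 => h; rewrite ltNge; apply/negP => s1; move/eqP: h; apply.
apply/max_idPl; rewrite subr_le0 -real_normK ?num_real//.
by rewrite exprn_ege1.
Qed.

Lemma dbump1_le s : `|dbump1 s| <= 4.
Proof.
rewrite /dbump1 normrM normrN; case: (leP 0 (1 - s ^+ 2)) => h.
  have s2 := sqr_ge0 s; rewrite [X in _ * X]ger0_norm// -[leRHS]mulr1.
  have s1 : `|s| <= 1.
    by rewrite -(@expr_le1 _ 2)// real_normK ?num_real//; lra.
  by rewrite ler_pM//; [rewrite normrM ger0_norm//; lra|lra].
by rewrite normr0 mulr0.
Qed.

Lemma continuous_dbump1 : continuous dbump1.
Proof.
move=> s; apply: cvgM.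
  by apply: cvgN; apply: cvgMr; exact: cvg_id.
apply: (@continuous_max _ _ (cst 0) (fun x : R => 1 - x ^+ 2)).
  exact: cvg_cst.
by apply: cvgB; [exact: cvg_cst|exact: exprn_continuous].
Qed.

End bump_profile.

Section bump.
Context {R : realType}.
Implicit Types (p z : 'rV[R]_2) (r : R).

Definition bump p r z : R :=
  r * bump1 ((z 0 0 - p 0 0) / r) * bump1 ((z 0 1 - p 0 1) / r).

Definition dbump p r z : 'rV[R]_2 :=
  let x := (z 0 0 - p 0 0) / r in let y := (z 0 1 - p 0 1) / r in
  pt (dbump1 x * bump1 y) (bump1 x * dbump1 y).

Lemma is_derive_bump1_scaled (a r x : R) :
  is_derive x 1 (fun x => bump1 ((x - a) / r)) (dbump1 ((x - a) / r) / r).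
Proof.
have h : is_derive x 1 (fun x : R => (x - a) / r) r^-1.
  have := is_deriveM (is_deriveB (is_derive_id x 1) (is_derive_cst a x 1))
    (is_derive_cst r^-1 x 1).
  by rewrite scaler0 add0r subr0 [_ *: _]mulr1.
exact: (@is_derive1_comp _ _ (fun x : R => (x - a) / r) x _ _
  (is_derive_bump1 _) h).
Qed.

Lemma bump_gradient p r z : 0 < r ->
  differentiable (bump p r) z /\ gradient (bump p r) z = dbump p r z.
Proof.
move=> r0; have rn0 := lt0r_neq0 r0.
have h0 : is_derive (z 0 0) 1 (fun x => r * bump1 ((x - p 0 0) / r))
    (dbump1 ((z 0 0 - p 0 0) / r)).
  have := is_deriveM (is_derive_cst r (z 0 0) 1)
    (is_derive_bump1_scaled (p 0 0) r (z 0 0)).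
  by rewrite scaler0 addr0 [_ *: _]mulrC divfK.
have [dif gE] := separable_gradient h0 (is_derive_bump1_scaled (p 0 1) r (z 0 1)).
split; first exact: dif.
rewrite [LHS]gE /dbump; congr pt.
by field.
Qed.

Lemma bump_ge0 p r z : 0 <= r -> 0 <= bump p r z.
Proof.
move=> r0; apply: mulr_ge0; last exact: bump1_ge0.
by apply: mulr_ge0 => //; exact: bump1_ge0.
Qed.

Lemma bump_le p r z : 0 <= r -> bump p r z <= r.
Proof.
move=> r0; rewrite /bump -mulrA ler_piMr// mulr_ile1 ?bump1_ge0//; exact: bump1_le1.
Qed.

Lemma bump_neq0 p r z : 0 < r -> bump p r z != 0 -> `|z - p| < r.
Proof.
move=> r0; rewrite /bump mulf_eq0 negb_or => /andP[+ y0].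
rewrite mulf_eq0 negb_or => /andP[_ x0].
have zx : `|(z - p) 0 0| < r.
  by have := bump1_neq0 x0; rewrite !mxE normrM normfV (gtr0_norm r0) ltr_pdivrMr// mul1r.
have zy : `|(z - p) 0 1| < r.
  by have := bump1_neq0 y0; rewrite !mxE normrM normfV (gtr0_norm r0) ltr_pdivrMr// mul1r.
apply: (@le_lt_trans _ _ (Num.max `|(z - p) 0 0| `|(z - p) 0 1|)); last first.
  by rewrite gt_max zx.
apply: row_norm_le; first by rewrite le_max normr_ge0.
by apply: rV2P; rewrite le_max lexx ?orbT.
Qed.

Lemma dbump_le p r z : `|dbump p r z| <= 4.
Proof.
have le4 (x y : R) : `|dbump1 x * bump1 y| <= 4.
  rewrite normrM -[leRHS]mulr1 ler_pM ?dbump1_le// ger0_norm ?bump1_ge0//.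
  exact: bump1_le1.
by apply: row_norm_le => //; apply: rV2P; rewrite mxE//= mulrC.
Qed.

Lemma continuous_dbump p r : continuous (dbump p r).
Proof.
move=> z.
have cx i : (fun y : 'rV[R]_2 => (y 0 i - p 0 i) / r) @ z --> (z 0 i - p 0 i) / r.
  exact: (cvgM (cvgB (@coord_continuous R 1 2 0 i z) (cvg_cst (p 0 i)))
    (cvg_cst r^-1)).
have cb i : (fun y : 'rV[R]_2 => bump1 ((y 0 i - p 0 i) / r)) @ z -->
    bump1 ((z 0 i - p 0 i) / r).
  apply: cvg_comp (cx i) _.
  by apply/differentiable_continuous/derivable1_diffP;
    have [] := is_derive_bump1 ((z 0 i - p 0 i) / r).
have cd i : (fun y : 'rV[R]_2 => dbump1 ((y 0 i - p 0 i) / r)) @ z -->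
    dbump1 ((z 0 i - p 0 i) / r).
  by apply: cvg_comp (cx i) _; exact: continuous_dbump1.
exact: (cvg_pt (cvgM (cd 0) (cb 1)) (cvgM (cb 0) (cd 1))).
Qed.

(** The slope is scale invariant: the gradient at half the radius above the center
is the same for all bumps. *)
Lemma bump_slope p r (q := p + pt 0 (r / 2)) : 0 < r ->
  bump p r q != 0 /\ dbump p r q = pt 0 (- (3 / 2)).
Proof.
move=> r0; have rn0 := lt0r_neq0 r0.
have q0 : q 0 0 - p 0 0 = 0 by rewrite !mxE/=; ring.
have q1 : q 0 1 - p 0 1 = r / 2 by rewrite !mxE/=; ring.
have b0 : bump1 (0 : R) = 1.
  by rewrite /bump1 expr0n/= subr0 (max_idPr _) ?expr1n.
have m : Num.max 0 (1 - 2^-1 ^+ 2) = 3 / 4 :> R.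
  by rewrite (max_idPr _); [field|rewrite subr_ge0; lra].
have b1 : bump1 (r / 2 / r) = (3 / 4) ^+ 2 :> R.
  by rewrite /bump1 [r / 2]mulrC mulfK// m.
rewrite /bump /dbump q0 q1 mul0r b0 b1; split.
  by rewrite mulr1 mulf_neq0// expf_neq0//; lra.
congr pt; first by rewrite /dbump1 mulr0 oppr0 !mul0r.
by rewrite mul1r /dbump1 [r / 2]mulrC mulfK// m; field.
Qed.

End bump.

(** * A flat field with an oscillating gradient *)

Section distance.
Context {R : realType} {V : normedModType R}.
Implicit Types (S : set V) (x y s : V).

Definition dist S x : R := inf [set `|x - s| | s in S].

Lemma dist_has_inf S x : S !=set0 -> has_inf [set `|x - s| | s in S].
Proof.
move=> [s Ss]; split; first by exists `|x - s|, s.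
by exists 0 => _ [t _ <-].
Qed.

Lemma dist_le S x s : S s -> dist S x <= `|x - s|.
Proof.
by move=> Ss; apply: ge_inf; [exists 0 => _ [t _ <-]|exists s].
Qed.

Lemma dist_ge0 S x : S !=set0 -> 0 <= dist S x.
Proof.
by move=> /(dist_has_inf x)[S0 _]; apply: lb_le_inf => // _ [t _ <-].
Qed.

Lemma dist_lipschitz S x y : S !=set0 -> dist S x <= dist S y + `|x - y|.
Proof.
move=> S0; rewrite -lerBlDr; apply: lb_le_inf; first by have [] := dist_has_inf y S0.
move=> _ [s Ss <-]; rewrite lerBlDr; apply: le_trans (dist_le x Ss) _.
by rewrite -[x - s](subrKA y) [leRHS]addrC ler_normD.
Qed.

Lemma dist_mem S x : S x -> dist S x = 0.
Proof.
move=> Sx; apply/eqP; rewrite eq_le dist_ge0 ?andbT; last by exists x.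
by have := dist_le x Sx; rewrite subrr normr0.
Qed.

Lemma dist_gt0 S x : closed S -> S !=set0 -> ~ S x -> 0 < dist S x.
Proof.
move=> cS S0 Sx.
have : \forall y \near x, (~` S) y.
  by apply: open_nbhs_nbhs; split => //; exact: closed_openC.
move=> /nbhs_normP[e /= e0 eS]; apply: lt_le_trans e0 _.
apply: lb_le_inf; first by have [] := dist_has_inf x S0.
by move=> _ [s Ss <-]; rewrite leNgt; apply/negP => /eS; apply.
Qed.

End distance.

(** In this section delta stands for the distance to S, and the distances d n of
the centers decrease geometrically.  The radius is at most d n / 4, so the
support of the n-th bump lies in the annulus where delta is between 3/4 d n and
5/4 d n.  These annuli are disjoint, and stay so after a slight enlargement. *)
Section bump_field.
Context {R : realType} (S : set 'rV[R]_2) (delta : 'rV[R]_2 -> R).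
Hypotheses (delta_mem : forall z, S z -> delta z = 0)
  (delta_gt0 : forall z, ~ S z -> 0 < delta z)
  (delta_lip : forall y z, delta y <= delta z + `|y - z|).
Context (p : nat -> 'rV[R]_2).
Hypotheses (Sp : forall n, ~ S (p n)).
Local Notation d n := (delta (p n)).
Hypotheses (d_le1 : d 0 <= 1) (d_decr : forall n, d n.+1 <= d n / 4).

Definition radius n := delta (p n) ^+ 2 / 4.
Local Notation r := radius.
Local Notation b n := (bump (p n) (r n)).

(** At most one bump is nonzero at z, so their sum is the value of that one; the
default index 0 gives the value zero when there is none. *)
Definition bump_field z : R := b (xget 0%N [set n | b n z != 0]) z.

Lemma delta_ge0 z : 0 <= delta z.
Proof. by have [/delta_mem ->|/delta_gt0/ltW] := pselect (S z). Qed.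

Lemma d_gt0 n : 0 < d n. Proof. exact: delta_gt0. Qed.

Lemma d_geometric n m : (n < m)%N -> d m <= d n / 4.
Proof.
elim: m => // m ih; rewrite ltnS leq_eqVlt => /predU1P[->//|/ih nm].
by have := d_decr m; have := d_gt0 m; lra.
Qed.

Lemma d_le n : d n <= 4^-1 ^+ n.
Proof.
elim: n => [|n ih]; first by rewrite expr0.
by rewrite exprSr; have := d_decr n; lra.
Qed.

Lemma radius_gt0 n : 0 < r n.
Proof. by rewrite divr_gt0 ?exprn_gt0 ?d_gt0. Qed.

Lemma radius_le n : r n <= d n / 4.
Proof.
rewrite ler_pM2r// expr2 ler_piMr ?(ltW (d_gt0 n))// (le_trans (d_le n))//.
by rewrite exprn_ile1//; lra.
Qed.

Lemma bump_annulus n z : b n z != 0 -> 3 / 4 * d n <= delta z <= 5 / 4 * d n.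
Proof.
move=> /(bump_neq0 (radius_gt0 n)) zp; have rd := radius_le n.
have := delta_lip z (p n); have := delta_lip (p n) z.
by rewrite distrC => h1 h2; apply/andP; split; lra.
Qed.

Lemma bump_unique z n m : b n z != 0 -> b m z != 0 -> n = m.
Proof.
move=> /bump_annulus/andP[n1 n2] /bump_annulus/andP[m1 m2].
have dn := d_gt0 n; have dm := d_gt0 m.
by have [/d_geometric h|/d_geometric h|//] := ltngtP n m; exfalso; lra.
Qed.

(** The annuli are apart from each other, so that a neighborhood of z of radius
delta z / 8 meets at most one of them. *)
Lemma bump_field_near z : ~ S z -> exists n, \forall y \near z, bump_field y = b n y.
Proof.
move=> Sz; have dz := delta_gt0 Sz.
have d8 : 0 < delta z / 8 by rewrite divr_gt0.
pose U := [set y | `|z - y| < delta z / 8].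
have UP y : U y -> 7 / 8 * delta z <= delta y <= 9 / 8 * delta z.
  rewrite /U/= => zy.
  have := delta_lip z y; have := delta_lip y z.
  by rewrite distrC => h1 h2; apply/andP; split; lra.
have single n m y y' : U y -> U y' -> b n y != 0 -> b m y' != 0 -> (n <= m)%N.
  move=> /UP/andP[y1 y2] /UP/andP[y3 y4] /bump_annulus/andP[n1 n2].
  move=> /bump_annulus/andP[m1 m2]; rewrite leqNgt; apply/negP => mn.
  by have := d_geometric mn; have := d_gt0 n; lra.
have nU : \forall y \near z, U y.
  exact: near_dist.
have [[n [y0 [Uy0 by0]]]|none] :=
    pselect (exists n, exists y, U y /\ b n y != 0).
  exists n; apply: filterS nU => y Uy; rewrite /bump_field.
  case: xgetP => [m _ /= bm|/= none]; last first.
    have bz m : b m y = 0 by apply/eqP; have /negP/negPn := none m.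
    by rewrite !bz.
  suff -> : m = n by [].
  by apply/anti_leq; rewrite (single m n y y0)//= (single n m y0 y).
exists 0%N; apply: filterS nU => y Uy.
have bz m : b m y = 0.
  by apply: contrapT => /eqP bm; apply: none; exists m, y.
by rewrite /bump_field !bz.
Qed.

Lemma bump_field_ge0 z : 0 <= bump_field z.
Proof. by apply: bump_ge0; exact/ltW/radius_gt0. Qed.

(** A bump is at most as high as its radius, which is quadratic in the distance to
S: this makes the field flat on S although its gradient oscillates there. *)
Lemma bump_field_le z : bump_field z <= delta z ^+ 2.
Proof.
rewrite /bump_field; set n := xget _ _.
have [->|bn] := eqVneq (b n z) 0; first by rewrite sqr_ge0.
apply: le_trans (bump_le _ _ (ltW (radius_gt0 n))) _.
have /andP[dz _] := bump_annulus bn; have d0 := d_gt0 n.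
by rewrite /r; nra.
Qed.

Lemma bump_field_mem z : S z -> bump_field z = 0.
Proof.
move=> Sz; apply/eqP; rewrite eq_le bump_field_ge0 andbT.
by rewrite (le_trans (bump_field_le z))// delta_mem// expr0n.
Qed.

Lemma bump_field_support z : bump_field z != 0 -> delta z <= 5 / 4.
Proof.
rewrite /bump_field; move: (xget _ _) => n /bump_annulus/andP[_ h].
suff : d n <= 1 by lra.
by apply: le_trans (d_le n) _; rewrite exprn_ile1//; lra.
Qed.

Lemma bump_field_is_diff_mem z : S z -> is_diff z bump_field 0.
Proof.
move=> Sz; apply: (@quadratic_is_diff _ _ _ _ 1); near=> y.
rewrite (bump_field_mem Sz) subr0 mul1r ger0_norm ?bump_field_ge0//.
apply: le_trans (bump_field_le y) _; rewrite lerXn2r ?nnegrE ?delta_ge0//.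
by have := delta_lip y z; rewrite (delta_mem Sz) add0r.
Unshelve. all: by end_near. Qed.

Lemma bump_field_gradient_mem z : S z -> gradient bump_field z = 0.
Proof.
move=> /bump_field_is_diff_mem[dz dE]; apply/rowP => i.
by rewrite !mxE deriveE// dE.
Qed.

Lemma bump_field_gradient_near z : ~ S z -> exists n, \forall y \near z,
  [/\ bump_field y = b n y, differentiable bump_field y &
      gradient bump_field y = dbump (p n) (r n) y].
Proof.
move=> /bump_field_near[n fb]; exists n.
have : \forall y \near z, \forall x \near y, bump_field x = b n x.
  exact/near_join.
apply: filterS => y fby; have [db gb] := bump_gradient (p n) y (radius_gt0 n).
split; first exact: nbhs_singleton fby.
  exact: near_eq_differentiable db.
by rewrite (near_eq_gradient fby).
Qed.

Lemma bump_field_differentiable z : differentiable bump_field z.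
Proof.
have [/bump_field_is_diff_mem[]//|] := pselect (S z).
by move=> /bump_field_gradient_near[n /nbhs_singleton[]].
Qed.

Lemma bump_field_gradient_le z : `|gradient bump_field z| <= 4.
Proof.
have [/bump_field_gradient_mem ->|] := pselect (S z); first by rewrite normr0.
by move=> /bump_field_gradient_near[n /nbhs_singleton[_ _ ->]]; exact: dbump_le.
Qed.

Lemma bump_field_gradient_continuous z : ~ S z ->
  {for z, continuous (gradient bump_field)}.
Proof.
move=> /bump_field_gradient_near[n nz].
have [_ _ gz] := nbhs_singleton nz.
suff : gradient bump_field @ z --> gradient bump_field z by [].
rewrite gz.
have cd : dbump (p n) (r n) @ z --> dbump (p n) (r n) z by exact: continuous_dbump.
apply: cvg_trans cd.
have fg : \forall y \near z, dbump (p n) (r n) y = gradient bump_field y.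
  by apply: filterS nz => y [].
exact: near_eq_cvg fg.
Qed.

Definition slope_point n := p n + pt 0 (r n / 2).

Lemma slope_point_close n : `|slope_point n - p n| <= 4^-1 ^+ n.
Proof.
rewrite /slope_point [p n + _]addrC addrK.
have h : 0 <= r n / 2 by rewrite ltW// divr_gt0 ?radius_gt0.
apply: (@le_trans _ _ (r n / 2)).
  by apply: row_norm_le => //; apply: rV2P; rewrite mxE/= ?normr0// ger0_norm.
have := d_le n; have := radius_le n; have := d_gt0 n; lra.
Qed.

(** The bump whose slope is considered is the one that the field coincides with near
this point, since only one bump is nonzero there. *)
Lemma bump_field_slope n :
  gradient bump_field (slope_point n) = pt 0 (- (3 / 2)).
Proof.
have [bn db] := bump_slope (p n) (radius_gt0 n).
have Sq : ~ S (slope_point n).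
  move=> /delta_mem dq; have /andP[] := bump_annulus bn.
  by rewrite -/(slope_point n) dq; have := d_gt0 n; lra.
have [m /nbhs_singleton[fb _ ->]] := bump_field_gradient_near Sq.
suff -> : m = n by [].
apply: (@bump_unique (slope_point n)) => //; rewrite -fb /bump_field.
by case: xgetP => [k _ //|/= H]; have := H n; rewrite bn.
Qed.

End bump_field.

Section dyadic_points.
Context {R : realType}.

Lemma invr_exp_le (m n : nat) : (1 < m)%N -> m%:R^-1 ^+ n <= n.+1%:R^-1 :> R.
Proof.
move=> m1; have m0 : (0 < m)%N by exact: ltnW.
by rewrite exprVn lef_pV2 ?posrE ?exprn_gt0 ?ltr0n// -natrX ler_nat ltn_expl.
Qed.

(** A sequence that comes back infinitely often near each point of [0, 1[: writing
n.+1 = 2 ^ k + j with j < 2 ^ k, its n-th term is j / 2 ^ k. *)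
Definition dyadic n : R := n.+1%:R / 2 ^+ trunc_log 2 n.+1 - 1.

Lemma dyadic01 n : 0 <= dyadic n <= 1.
Proof.
rewrite /dyadic; have /andP[l u] := @trunc_log_bounds 2 n.+1 isT isT.
have p0 : 0 < 2 ^+ trunc_log 2 n.+1 :> R by rewrite exprn_gt0.
rewrite subr_ge0 lerBlDr ler_pdivlMr// ler_pdivrMr// mul1r -natrX ler_nat l/=.
by rewrite (_ : 1 + 1 = 2%:R)// -natrM ler_nat -expnS ltnW.
Qed.

Lemma dyadic_dense (t : R) k : 0 <= t < 1 -> exists2 n, (k <= n)%N &
  `|dyadic n - t| <= k.+1%:R^-1.
Proof.
move=> /andP[t0 t1]; set j := Num.truncn (t * 2 ^+ k).
have p0 : 0 < 2 ^+ k :> R by rewrite exprn_gt0.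
have /andP[jl ju] := truncn_itv (mulr_ge0 t0 (ltW p0)).
have jk : (j < 2 ^ k)%N.
  by rewrite -(ltr_nat R) natrX (le_lt_trans jl)// -[ltRHS]mul1r ltr_pM2r.
have e0 : (0 < 2 ^ k)%N by rewrite expn_gt0.
exists (2 ^ k + j).-1.
  rewrite -ltnS prednK ?addn_gt0 ?e0//.
  by apply: leq_trans (leq_addr _ _); exact: ltn_expl.
rewrite /dyadic prednK ?addn_gt0 ?e0//.
rewrite (@trunc_log_eq 2 k)//; last first.
  by rewrite leq_addr expnS mul2n -addnn ltn_add2l jk.
rewrite natrD natrX mulrDl divff ?gt_eqF// [1 + _]addrC addrK.
apply: le_trans (@invr_exp_le 2 k isT).
rewrite exprVn -[leRHS]mul1r ler_pdivlMr//.
rewrite (_ : `|_| * _ = `|(j%:R / 2 ^+ k - t) * 2 ^+ k|); last first.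
  by rewrite normrM (ger0_norm (ltW p0)).
rewrite mulrBl divfK ?gt_eqF// ler_norml.
move: ju; rewrite -natr1 => ju.
by apply/andP; split; lra.
Qed.

End dyadic_points.

Section approaching_points.
Context {R : realType} (S : set 'rV[R]_2).
Hypotheses (cS : closed S) (iS : interior S = set0).
Hypotheses (S1 : forall z, S z -> `|z| <= 1).
Hypothesis (Sproj : forall t, 0 <= t <= 1 -> exists2 z, S z & z 0 1 = t).

(** s n is a point of S of second coordinate [dyadic n], and p n a point outside S
so close to s n that the distances to S decrease geometrically.  For t in [0, 1[,
the points s n with [dyadic n] close to t have a cluster point in the compact
set S; its second coordinate is t, and it is a limit of points p n. *)
Lemma approaching_points : exists p : nat -> 'rV[R]_2,
  [/\ forall n, ~ S (p n), dist S (p 0%N) <= 1,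
      forall n, dist S (p n.+1) <= dist S (p n) / 4 &
      forall t, 0 <= t < 1 -> exists2 x, S (pt x t) &
        exists m : nat -> nat, forall k, (k <= m k)%N /\
          `|pt x t - p (m k)| <= 2 / k.+1%:R].
Proof.
have /choice[s sP] : forall n, exists z : 'rV[R]_2, S z /\ z 0 1 = dyadic n.
  move=> n; by have [z Sz zn] := Sproj (dyadic01 n); exists z.
have S0 : S !=set0 by exists (s 0%N); have [] := sP 0%N.
have /choice[q qP] : forall ne : nat * R, exists z : 'rV[R]_2, 0 < ne.2 ->
    ~ S z /\ `|z - s ne.1| < ne.2.
  move=> [n e] /=.
  have [e0|e0] := pselect (0 < e); last by exists 0.
  apply: contrapT => H.
  suff nS : nbhs (s n) S by have : interior S (s n) by []; rewrite iS.
  apply: filterS (near_dist (s n) e0) => z zs; apply: contrapT => Sz.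
  by apply: H; exists z => _; split => //; rewrite distrC.
(* how close p n.+1 must be to S depends on the choice of p n *)
pose p := fix p n := if n is m.+1 then q (m.+1, dist S (p m) / 4) else q (0%N, 1).
have pS n : ~ S (p n).
  elim: n => [|n ih] /=; first by have [] := qP (0%N, 1) ltr01.
  by have [] := qP (n.+1, dist S (p n) / 4) (divr_gt0 (dist_gt0 cS S0 ih) _).
have d0 : dist S (p 0%N) <= 1.
  have [_ /ltW] := qP (0%N, 1) ltr01; apply: le_trans.
  by apply: dist_le; have [] := sP 0%N.
have ps n : `|p n.+1 - s n.+1| < dist S (p n) / 4.
  by have [] := qP (n.+1, dist S (p n) / 4) (divr_gt0 (dist_gt0 cS S0 (pS n)) _).
have dS n : dist S (p n.+1) <= dist S (p n) / 4.
  apply: le_trans (ltW (ps n)).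
  by apply: dist_le; have [] := sP n.+1.
have psle n : `|p n - s n| <= 4^-1 ^+ n.
  case: n => [|n]; first by have [_ /ltW] := qP (0%N, 1) ltr01; rewrite expr0.
  apply: le_trans (ltW (ps n)) _; rewrite exprSr ler_pM2r//.
  exact: (@d_le R (dist S) p d0 dS).
exists p; split => // t t01.
have /choice[i iP] : forall k, exists n, (k <= n)%N /\
    `|dyadic n - t| <= k.+1%:R^-1.
  by move=> k; have [n] := dyadic_dense k t01; exists n.
have compS : compact S.
  apply: bounded_closed_compact => //; exists 1; split; first exact: num_real.
  by move=> M M1 z /S1 /le_trans; apply; exact: ltW.
have [|z [Sz zcl]] := compS ((s \o i) @ \oo) _.
  by exists 0%N => // k _ /=; have [] := sP (i k).
have /choice[j jP] : forall k, exists n, (k <= n)%N /\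
    `|z - s (i n)| < k.+1%:R^-1.
  move=> k.
  have e0 : 0 < k.+1%:R^-1 :> R by rewrite invr_gt0.
  have [||_ [[n kn <-] zn]] := zcl [set s (i n) | n in [set n | (k <= n)%N]]
      [set y | `|z - y| < k.+1%:R^-1].
  - by exists k => // n /= kn; exists n.
  - exact: (@near_dist R 'rV[R]_2 z _ e0).
  - by exists n.
have inv_mono (a b : nat) : (a <= b)%N -> b.+1%:R^-1 <= a.+1%:R^-1 :> R.
  by move=> ab; rewrite lef_pV2 ?posrE// ler_nat.
have zt : z 0 1 = t.
  apply/eqP; rewrite -subr_eq0 -normr_le0; apply/ler_addgt0Pr => e e0.
  rewrite add0r; have [k ke] : exists k, k.+1%:R^-1 < e / 2.
    near \oo => k; exists k; near: k.
    by apply: near_infty_natSinv_lt (PosNum (divr_gt0 e0 _)).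
  have [kj zk] := jP k; have [_ st] := sP (i (j k)).
  have [_ it] := iP (j k).
  rewrite -(subrKA (s (i (j k)) 0 1)) (le_trans (ler_normD _ _))//.
  have : `|z 0 1 - s (i (j k)) 0 1| <= `|z - s (i (j k))|.
    by apply: le_trans (row_norm_ge _ 1); rewrite !mxE.
  have st' : `|s (i (j k)) 0 1 - t| <= (j k).+1%:R^-1 by rewrite st.
  move=> zs; apply: le_trans (lerD (le_trans zs (ltW zk)) st') _.
  move: (inv_mono _ _ kj) ke; move: (k.+1%:R^-1) ((j k).+1%:R^-1) => x y.
  by lra.
exists (z 0 0); first by rewrite -zt pt_eta.
exists (i \o j) => k /=; have [kj zk] := jP k; have [ji _] := iP (j k).
split; first exact: leq_trans ji.
rewrite -zt pt_eta -(subrKA (s (i (j k)))) (le_trans (ler_normD _ _))//.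
rewrite mulr_natl mulr2n lerD// ?(ltW zk)// distrC.
apply: le_trans (psle _) _; apply: le_trans (invr_exp_le _ _) _ => //.
exact: inv_mono _ _ (leq_trans kj ji).
Unshelve. all: by end_near. Qed.

End approaching_points.

Section oscillating_field.
Context {R : realType} (S : set 'rV[R]_2).
Hypotheses (cS : closed S) (iS : interior S = set0).
Hypotheses (S1 : forall z, S z -> `|z| <= 1).
Hypothesis (Sproj : forall t, 0 <= t <= 1 -> exists2 z, S z & z 0 1 = t).

Lemma dist_far (x t : R) : 3 <= x -> 2 <= dist S (pt x t).
Proof.
move=> x3; apply: lb_le_inf => [|_ [s Ss <-]].
  have [|z Sz _] := @Sproj 0; first by rewrite lexx ler01.
  by exists `|pt x t - z|, z.
apply: le_trans (row_norm_ge _ 0); rewrite mxE pt0 mxE.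
have := le_trans (ler_norm _) (le_trans (row_norm_ge s 0) (S1 Ss)).
by move=> s1; apply: le_trans (ler_norm _); lra.
Qed.

(** The points u k of the last item are the points of slope -3/2 of the bumps whose
centers tend to (x, t). *)
Lemma oscillating_field : exists f : 'rV[R]_2 -> R,
  [/\ forall z, 0 <= f z,
      forall z, S z -> f z = 0 /\ gradient f z = 0,
      forall x t, 3 <= x -> f (pt x t) = 0,
      [/\ forall z, differentiable f z, forall z, `|gradient f z| <= 4 &
          forall z, ~ S z -> {for z, continuous (gradient f)}] &
      forall t, 0 <= t < 1 -> exists2 x, S (pt x t) &
        exists2 u : nat -> 'rV[R]_2, u @ \oo --> pt x t &
          forall k, gradient f (u k) = pt 0 (- (3 / 2))].
Proof.
have S0 : S !=set0.
  by have [|z Sz _] := @Sproj 0; [rewrite lexx ler01|exists z].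
have [p [pS d0 dS pcl]] := approaching_points cS iS S1 Sproj.
have dmem z : S z -> dist S z = 0 by exact: dist_mem.
have dgt0 z : ~ S z -> 0 < dist S z by exact: dist_gt0.
have dlip (y z : 'rV[R]_2) : dist S y <= dist S z + `|y - z|.
  exact: dist_lipschitz.
exists (bump_field (dist S) p); split.
- exact: (bump_field_ge0 dgt0 pS).
- move=> z Sz; split; first exact: (bump_field_mem dmem dgt0 dlip pS d0 dS).
  exact: (bump_field_gradient_mem dmem dgt0 dlip pS d0 dS).
- move=> x t x3; apply: contrapT => /eqP.
  move=> /(bump_field_support dgt0 dlip pS d0 dS).
  have := dist_far t x3; move: (dist S _) => a a2 a54; lra.
- split.
  + exact: (bump_field_differentiable dmem dgt0 dlip pS d0 dS).
  + exact: (bump_field_gradient_le dmem dgt0 dlip pS d0 dS).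
  + exact: (bump_field_gradient_continuous dgt0 dlip pS d0 dS).
move=> t /pcl[x Sxt [m mP]]; exists x => //.
exists (fun k => slope_point (dist S) p (m k)); last first.
  by move=> k; exact: (bump_field_slope dmem dgt0 dlip pS d0 dS).
apply/cvgrPdist_lt => e e0; near=> k.
have [km pm] := mP k.
rewrite -(subrKA (p (m k))) (le_lt_trans (ler_normD _ _))//.
have inv_e : k.+1%:R^-1 < e / 3.
  by near: k; apply: near_infty_natSinv_lt (PosNum (divr_gt0 e0 _)).
apply: (@le_lt_trans _ _ (2 / k.+1%:R + k.+1%:R^-1)); last first.
  by move: inv_e; move: (k.+1%:R^-1) => a; lra.
apply: lerD => //; rewrite distrC.
apply: le_trans (slope_point_close dgt0 pS d0 dS _) _.
apply: le_trans (invr_exp_le _ _) _ => //.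
by rewrite lef_pV2 ?posrE// ler_nat.
Unshelve. all: by end_near. Qed.

End oscillating_field.

(** * Non-definability *)

Section non_definability.
Context {R : realType}.

Lemma sin_npi n : sin (n%:R * pi) = 0 :> R.
Proof.
elim: n => [|n ih]; first by rewrite mul0r sin0.
by rewrite -natr1 mulrDl mul1r sinDpi ih oppr0.
Qed.

(** By the pigeonhole principle some interval would contain two multiples of pi,
hence also a point k * pi + pi / 2, where the sine is not zero. *)
Lemma sin_zeros_not_itvs (s : seq (interval R)) :
  [set x : R | sin x = 0] <> [set x | exists2 I, I \in s & x \in I].
Proof.
move=> E.
have zI (k : 'I_(size s).+1) : exists i : 'I_(size s),
    (k%:R * pi : R) \in nth `]0, 0[ s i.
  have : [set x | exists2 I, I \in s & x \in I] (k%:R * pi).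
    by rewrite -E /=; exact: sin_npi.
  move=> [I Is kI]; have iI : (index I s < size s)%N by rewrite index_mem.
  by exists (Ordinal iI); rewrite /= nth_index.
have /choice[i iP] := zI.
have iinj : injective i.
  suff lt_absurd (k l : 'I_(size s).+1) : (k < l)%N -> i k = i l -> False.
    move=> k l ikl; apply/val_inj/eqP.
    case: ltngtP => // kl; exfalso; first exact: lt_absurd kl ikl.
    exact: lt_absurd kl (esym ikl).
  move=> kl ikl.
  pose x : R := k%:R * pi + pi / 2.
  have xI : x \in nth `]0, 0[ s (i k).
    apply: (@interval_is_interval _ (nth `]0, 0[ s (i k)) (k%:R * pi) (l%:R * pi)).
    - exact: iP.
    - by rewrite /= ikl; exact: iP.
    - have pi0 := pi_gt0 R; rewrite /x; apply/andP; split; first by lra.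
      have : (k%:R + 1 : R) * pi <= l%:R * pi.
        by rewrite ler_pM2r// natr1 ler_nat.
      by rewrite mulrDl mul1r; lra.
  have : sin x = 0.
    suff : [set x : R | sin x = 0] x by [].
    rewrite E; exists (nth `]0, 0[ s (i k)) => //.
    by apply: mem_nth; exact: ltn_ord.
  rewrite sinDpihalf => c0; have := cos2Dsin2 (k%:R * pi : R).
  by rewrite c0 sin_npi expr0n/= addr0 => /eqP; rewrite eq_sym oner_eq0.
by have := leq_card _ iinj; rewrite !card_ord ltnn.
Qed.

(** Cutting the graph of F along the line x = a and at height 0 defines the zero set
of the sine function.  Since only the last coordinate can be projected away, a
copy of t is first added in front of (x, t, y). *)
Lemma sine_section_not_definable (F : 'rV[R]_2 -> R) (a : R) :
  (forall t, F (pt a t) = sin t) ->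
  forall M : forall n : nat, set (set 'rV[R]_n),
    o_minimal_structure M -> ~ definable M F.
Proof.
move=> Fsin M oM MF.
have M1T : M 1%N setT.
  by have := omin_algebraic oM (n := 1) [::]; congr M; apply/seteqP; split.
pose X (i : 'I_4) : mpoly.mpoly 4 R := mpoly.mpolyX R (mpoly.mnm1 i).
pose ps := [:: X 0 - X 2; X 1 - mpoly.mpolyC 4 a; X 3].
have M4 := omin_setI oM (omin_setX oM M1T MF) (omin_algebraic oM ps).
have {}M4 : M 4%N [set z : 'rV[R]_4 | [/\ z 0 3 = F (pt (z 0 1) (z 0 2)),
    z 0 0 = z 0 2, z 0 1 = a & z 0 3 = 0]].
  have := M4; congr (M _ _); apply/seteqP.
  have zF (z : 'rV[R]_(1 + (2 + 1))) :
      rsubmx (rsubmx z) 0 0 = z 0 3 /\ lsubmx (rsubmx z) = pt (z 0 1) (z 0 2).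
    split; first by rewrite !mxE; congr (z _ _); exact/val_inj.
    by apply/rowP; apply: rV2P; rewrite !mxE/=; congr (z _ _); exact/val_inj.
  split => z /=; have [z3E zlE] := zF z; rewrite z3E zlE.
    move=> [[_ zf] zps]; split => //.
    - have /zps : X 0 - X 2 \in ps by rewrite inE eqxx.
      by rewrite mevalB !mevalXU => /subr0_eq.
    - have /zps : X 1 - mpolyC 4 a \in ps by rewrite !inE eqxx orbT.
      by rewrite mevalB mevalXU mevalC => /subr0_eq.
    - have /zps : X 3 \in ps by rewrite !inE eqxx !orbT.
      by rewrite mevalXU.
  move=> [zf z02 z1 z3]; split => // q; rewrite !inE => /or3P[] /eqP ->.
  - by rewrite mevalB !mevalXU z02 subrr.
  - by rewrite mevalB mevalXU mevalC z1 subrr.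
  - by rewrite mevalXU.
have := omin_proj oM (n := 1) (omin_proj oM (n := 2) (omin_proj oM (n := 3) M4)).
move=> /(omin_line oM)[s As].
apply: (@sin_zeros_not_itvs s); apply/seteqP; split => x /=.
  move=> sx; suff : [set x : 'rV[R]_1 | exists2 I, I \in s & x 0 0 \in I] (const_mx x).
    by move=> [I Is]; rewrite mxE => xI; exists I.
  rewrite -As /=.
  pose z : 'rV[R]_4 := \row_j nth 0 [:: x; a; x; 0] j.
  have z4 : [/\ z 0 3 = F (pt (z 0 1) (z 0 2)),
    z 0 0 = z 0 2, z 0 1 = a & z 0 3 = 0] by rewrite !mxE/= Fsin sx.
  exists (lsubmx (lsubmx (z : 'rV[R]_(2 + 1 + 1)))).
    exists (lsubmx (z : 'rV[R]_(3 + 1))) => //.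
    by exists z.
  by apply/rowP => j; rewrite !mxE (ord1 j).
move=> [I Is xI].
have : [set x : 'rV[R]_1 | exists2 I, I \in s & x 0 0 \in I] (const_mx x).
  by exists I => //; rewrite mxE.
rewrite -As => -[y [w [z [z3 z02 z1 z30] <-] <-]] /rowP/(_ 0).
rewrite !mxE => <-.
move: z3; rewrite z1 Fsin z30 -z02 => /esym sz; rewrite -[RHS]sz.
by congr (sin (z _ _)); exact/val_inj.
Qed.

End non_definability.

(** * Parametric minimization on a strip *)

Section parametric.
Context {R : realType}.
Local Notation mu := (@lebesgue_measure R).

Lemma clarke_limit n (phi : 'rV[R]_n -> R) (u : nat -> 'rV[R]_n) x v :
  (forall k, differentiable phi (u k)) -> u @ \oo --> x ->
  (fun k => gradient phi (u k)) @ \oo --> v -> clarke phi x v.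
Proof. by move=> du ux uv; apply: sub_gen_smallest; exists u. Qed.

(** The multiplier is zero here, so the constraint disappears from the condition. *)
Lemma D_value_inactive (F G : 'rV[R]_2 -> R) t x u :
  Sol_p F G t x -> clarke F (pt x t) (pt 0 u) -> D_value F G t u.
Proof.
move=> xsol cu; exists (x, 0); last exists (pt 0 u) => //.
  split => //=; first by rewrite mul0r.
  by exists 0; [exists u|rewrite mul0r addr0].
by rewrite /= mul0r; apply/rowP => i; rewrite !mxE if_same addr0.
Qed.

(** Along the curve t |-> t, whose velocity is 1, the chain rule makes all elements
of D t equal to the derivative of f for almost every t. *)
Lemma not_conservative_field_line (f : R -> R) (D : R -> set R) (u v : R -> R) :
  (forall t, 0 < t < 1 -> D t (u t) /\ D t (v t)) ->
  (forall t, 0 < t < 1 -> u t != v t) ->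
  ~ conservative_field_line f D.
Proof.
move=> Duv uv [_ _ _ /(_ (fun t => const_mx t))].
have cac : absolutely_continuous_on 0 1 (fun t : R => const_mx t : 'rV[R]_1).
  move=> e e0; exists e => // m s t st _; apply: le_lt_trans.
  apply: ler_sum => i _; have [_ le_st _] := st i.
  apply: row_norm_le; first by rewrite subr_ge0.
  by move=> j; rewrite !mxE ger0_norm// subr_ge0.
move=> /(_ cac) chain.
have : mu.-negligible `]0 : R, 1[%classic.
  apply: negligibleS chain => t /= t01 /(_ _)[].
    by move: t01; rewrite in_itv/= => /andP[/ltW -> /ltW ->].
  move=> dt _ dotE; move: t01; rewrite in_itv/= => t01.
  have [Du Dv] := Duv t t01; move/eqP: (uv t t01); apply.
  have dE (w : R) :
      dot ('D_1 (fun t : R => const_mx t : 'rV[R]_1) t) (const_mx w) = w.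
    rewrite /dot big_ord1 derive_mx// !mxE.
    rewrite (_ : (fun s : R => _) = id) ?derive_id ?mul1r//.
    by apply/funext => s; rewrite mxE.
  rewrite -(dE (u t)) -(dE (v t)) -!dotE//=; first by rewrite !mxE.
  by rewrite !mxE.
move=> /negligibleP => /(_ (measurable_itv _)).
rewrite [X in X = _ -> _](@lebesgue_measure_itv R `]0, 1[)/= lte_fin ltr01.
by rewrite oppr0 adde0 => /eqP; rewrite eqe oner_eq0.
Qed.

End parametric.

Section strip.
Context {R : realType}.
Implicit Types (x t : R).

Definition strip (z : 'rV[R]_2) : R := z 0 0 ^+ 2 - 4.

Lemma strip_feasible x t : strip (pt x t) <= 0 <-> `|x| <= 2.
Proof.
rewrite /strip pt0 subr_le0 (_ : 4 = 2 ^+ 2 :> R); last by ring.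
by rewrite -real_normK ?num_real// ler_pXn2r ?nnegrE.
Qed.

Lemma strip_qualification x t : constraint_qualification strip x t.
Proof.
move=> l + _; rewrite /dx /strip.
rewrite (_ : (fun y : R => _) = (fun y => y ^+ 2 - 4)); last first.
  by apply/funext => y; rewrite pt0.
have [_ ->] : is_derive x 1 (fun y : R => y ^+ 2 - 4) (2 * x).
  have := is_deriveB (is_deriveX 2 (is_derive_id x 1)) (is_derive_cst (4 : R) x 1).
  by rewrite subr0 [_ *: _]mulr1 expr1.
rewrite pt0 => lx lG.
have : 4 * l = 0.
  have -> : 4 * l = (l * (2 * x)) * x / 2 - l * (x ^+ 2 - 4) by field.
  by rewrite lx lG; ring.
by move=> /eqP; rewrite mulf_eq0 pnatr_eq0/= => /eqP.
Qed.

Lemma strip_Sol_p_neq0 (F : 'rV[R]_2 -> R) t :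
  (forall z, differentiable F z) -> Sol_p F strip t !=set0.
Proof.
move=> dF; have le22 : -2 <= 2 :> R by lra.
have [|c cI cmin] := @EVT_min R (fun x => F (pt x t)) _ _ le22.
  apply: continuous_subspaceT => x.
  have ptx : (fun y : R => pt y t) @ x --> pt x t.
    by apply: cvg_pt; [exact: cvg_id|exact: cvg_cst].
  exact: cvg_comp ptx (differentiable_continuous (dF (pt x t))).
exists c; split.
  by apply/strip_feasible; move: cI; rewrite in_itv/= ler_norml.
by move=> y /strip_feasible; rewrite ler_norml => yI; apply: cmin; rewrite in_itv.
Qed.

Lemma strip_Sol_p_bounded (F : 'rV[R]_2 -> R) : locally_bounded (Sol_p F strip).
Proof.
move=> t; exists setT; first exact: filterT.
exists 2; split; first exact: num_real.
by move=> M M2 x [s _ [/strip_feasible]] x2 _; exact: le_trans x2 (ltW M2).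
Qed.

End strip.

(** * The counterexample *)

Theorem claim5p1 (R : realType) (P : {set 'I_4 * 'I_4})
    (hP : admissible_positions R P) :
  let S : set 'rV[R]_2 := fractal R P in
  let G : 'rV[R]_2 -> R := fun z => z 0 0 ^+ 2 - 4 in
  exists F : 'rV[R]_2 -> R,
    [/\ locally_lipschitz F,
        (forall M : forall n : nat, set (set 'rV[R]_n),
            o_minimal_structure M -> ~ definable M F),
        [/\ (forall z : 'rV[R]_2, differentiable F z), path_differentiable F &
            continuously_differentiable (~` S) F],
        ~ conservative_field_line (value_function F G) (D_value F G) &
        [/\ (forall x t : R, G (pt x t) <= 0 -> constraint_qualification G x t),
            (forall t : R, Sol_p F G t !=set0) &
            locally_bounded (Sol_p F G)]].
Proof.
move=> S G.
have cS : closed S := fractal_closed hP.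
have S0 : S !=set0 := fractal_nonempty hP.
have S01 z i : S z -> 0 <= z 0 i <= 1.
  move=> Sz; move: i; apply: rV2P.
    suff : [set` `[0, 1]] (z 0 0) by rewrite /= in_itv.
    by rewrite -(fractal_proj_fst hP); exists z.
  suff : [set` `[0, 1]] (z 0 1) by rewrite /= in_itv.
  by rewrite -(fractal_proj_snd hP); exists z.
have S1 z : S z -> `|z| <= 1.
  by move=> Sz; apply: row_norm_le => // i; have /andP[? ?] := S01 z i Sz; rewrite ger0_norm.
have Sproj t : 0 <= t <= 1 -> exists2 z, S z & z 0 1 = t.
  move=> t01; have : [set z 0 1 | z in S] t by rewrite (fractal_proj_snd hP)/= in_itv.
  by move=> [z Sz zt]; exists z.
have [f [f0 fS ffar [df gf cf] fosc]] :=
  oscillating_field cS (fractal_interior hP) S1 Sproj.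
pose F : 'rV[R]_2 -> R := sine2 + f.
have dF z : differentiable F z.
  by apply: differentiableD => //; exact: (sine2_gradient z).1.
have gF z : gradient F z = gradient (@sine2 R) z + gradient f z.
  by apply: gradientD => //; exact: (sine2_gradient z).1.
have gF5 z : `|gradient F z| <= 5.
  rewrite gF (_ : 5 = 1 + 4); last by ring.
  apply: le_trans (ler_normD _ _) _; apply: lerD => //.
  rewrite (sine2_gradient z).2; apply: row_norm_le => //.
  by apply: rV2P; rewrite mxE/= ?normr0// ler_norml cos_geN1 cos_le1.
have cF z : ~ S z -> {for z, continuous (gradient F)}.
  move=> /cf cf0; suff : gradient F @ z --> gradient F z by [].
  have csine : gradient (@sine2 R) @ z --> pt 0 (cos (z 0 1)).
    exact: (@sine2_gradient_cvg _ _ (nbhs z) _ id z cvg_id).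
  rewrite gF (sine2_gradient z).2 (funext gF).
  exact: cvgD csine cf0.
have [e1 [e2 [n1 n2 n12 frame]]] := fractal_proj_frame hP.
have null := null_frame_velocity n1 n2 n12 (fun e he => (frame e he).2).
exists F; split.
- exact: gradient_bounded_locally_lipschitz dF gF5.
- apply: (@sine_section_not_definable _ F 3) => t.
  by rewrite /F addrfctE ffar// addr0 /sine2 pt1.
- split => //; first exact: path_differentiable_off_null cS dF gF5 cF null.
  by move=> z Sz; split => //; exact: cF.
- apply: (@not_conservative_field_line _ _ _ (@cos R) (fun t => cos t - 3 / 2)); last first.
    by move=> t _; apply/eqP => h; lra.
  move=> t /andP[t0 t1].
  have [x Sxt [u ux gu]] := fosc t (introT andP (conj (ltW t0) t1)).
  have sol : Sol_p F G t x.
    split.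
      apply/(strip_feasible x t); have := row_norm_ge (pt x t) 0.
      by rewrite pt0 => /le_trans; apply; apply: le_trans (S1 _ Sxt) _; lra.
    by move=> y _; rewrite /F !addrfctE /sine2 !pt1 lerD2l (fS _ Sxt).1.
  split; apply: (D_value_inactive sol).
    apply: (@clarke_limit _ _ _ (fun=> pt x t)) => //; first exact: cvg_cst.
    have -> : pt 0 (cos t) = gradient F (pt x t).
      by rewrite gF (sine2_gradient _).2 pt1 (fS _ Sxt).2 addr0.
    exact: cvg_cst.
  (* the other element comes from the slopes of the bumps *)
  apply: (@clarke_limit _ _ _ u) => //.
  have -> : (fun k => gradient F (u k)) =
      (fun k => gradient (@sine2 R) (u k)) + cst (pt 0 (- (3 / 2))).
    by apply/funext => k; rewrite gF gu.
  have -> : pt 0 (cos t - 3 / 2) = pt 0 (cos (pt x t 0 1)) + pt 0 (- (3 / 2)).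
    by apply/rowP; apply: rV2P; rewrite !mxE/= ?addr0.
  by apply: cvgD; [exact: sine2_gradient_cvg|exact: cvg_cst].
- split.
  + by move=> x t _; exact: strip_qualification.
  + by move=> t; exact: strip_Sol_p_neq0.
  + exact: strip_Sol_p_bounded.
Qed.
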